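(* Let $\mathbb{H}$ be an infinite vertex-transitive strongly transient graph of finite degree. Then, for the simple random walk on $\mathbb{H}$ started at $v\in V(\mathbb{H})$ with $n$-step trace $G_n^{\mathbb{H}}$, and the diametrical-path estimator $\Psi$, $$\liminf_{n\to\infty}\mathbb{P}_v\big(\Psi(G_n^{\mathbb{H}})=v\big)>0.$$ In particular, this holds for $\mathbb{H}=\mathbb{Z}^d$ for every $d\ge 5$.
   Context: $(X_n)_{n\ge0}$ is the simple random walk on $\mathbb{H}$; $\mathbb{P}_v$ is its law when started at the source $X_0=v$. The walk (or $\mathbb{H}$) is transient if it does not return to its starting vertex almost surely; it is strongly transient if it is transient and $\mathbb{E}[\tau_v^+\mid X_0=v,\ \tau_v^+<\infty]<\infty$, where $\tau_v^+=\inf\{t>0: X_t=v\}$. The $n$-step trace $G_n^{\mathbb{H}}$ is the (simple, undirected) subgraph of $\mathbb{H}$ consisting of the vertices $X_0,\dots,X_n$ and the edges $\{X_i,X_{i+1}\}$, $0\le i<n$. For a finite connected graph $G$, a diametrical path is a path in $G$ of length $\mathrm{diam}(G)$ joining two vertices at graph distance $\mathrm{diam}(G)$. The estimator $\Psi$ is the randomised function which, on input $G$, selects a uniformly random diametrical path of $G$ and outputs one of its two endpoints uniformly at random (this randomness being, conditionally on $G$, independent of the walk). The probability $\mathbb{P}_v(\Psi(G_n^{\mathbb{H}})=v)$ does not depend on $v$, by vertex-transitivity. $\mathbb{Z}^d$ denotes the nearest-neighbour lattice graph. *)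

(* Defs.v *)
From mathcomp Require Import all_boot all_order all_algebra.
From mathcomp Require Import finmap.
From mathcomp Require Import all_classical all_reals all_analysis.
Set Implicit Arguments.
Unset Strict Implicit.
Unset Printing Implicit Defensive.
Import Order.TTheory GRing.Theory Num.Theory.
Local Open Scope classical_set_scope.
Local Open Scope ring_scope.

(* A simple graph on the vertex set V is a symmetric irreflexive relation. *)

Definition locally_finite (V : choiceType) (H : rel V) : Prop :=
  forall x, finite_set [set y | H x y].

Definition degree (V : choiceType) (H : rel V) (x : V) : nat :=
  #|` fset_set [set y | H x y]|.

Definition vertex_transitive (V : choiceType) (H : rel V) : Prop :=
  forall x y, exists f : V -> V,
    [/\ bijective f, forall a b, H (f a) (f b) = H a b & f x = y].

Definition lattice (d : nat) : rel 'rV[int]_d :=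
  fun x y => \sum_(i < d) `|x 0 i - y 0 i| == 1.

Section FiniteGraphs.
Variable V : choiceType.

(* Finite graphs whose vertices are taken from V; only the restriction of
   subgraph_adj to subgraph_verts is ever used. *)
Record subgraph := Subgraph { subgraph_verts : {fset V}; subgraph_adj : rel V }.

Definition trace (x : nat -> V) (n : nat) : subgraph :=
  Subgraph [fset x (nat_of_ord i) | i in 'I_n.+1]%fset
    (fun a b => [exists i : 'I_n, ((a == x i) && (b == x i.+1))
                               || ((b == x i) && (a == x i.+1))]).

Variable G : subgraph.
Let T : finType := subgraph_verts G.

Definition gadj : rel T := fun a b => subgraph_adj G (val a) (val b).

Definition has_walk (a b : T) (k : nat) : bool :=
  [exists p : k.-tuple T, path gadj a p && (last a p == b)].

(* Two vertices of the same component are joined by a walk with fewer than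
   #|T| steps, so the search succeeds; the value is #|T| across components. *)
Definition gdist (a b : T) : nat := find (has_walk a b) (iota 0 #|T|).

Definition gdiam : nat := (\max_(a : T) \max_(b : T) gdist a b)%N.

(* A walk whose length equals the distance of its ends has no repeated vertex.
   A path of positive length is listed in both of its orientations, which does
   not affect the uniform choice of a path followed by that of an endpoint. *)
Definition diametrical_paths : {set gdiam.+1.-tuple T} :=
  [set p : gdiam.+1.-tuple T | sorted gadj p
     && (gdist (tnth p ord0) (tnth p ord_max) == gdiam)]%SET.

(* The probability that the estimator, given G, outputs y. *)
Definition Psi_law (R : realType) (y : V) : R :=
  \sum_(p in diametrical_paths) #|diametrical_paths|%:R^-1 *
    (2^-1 * (val (tnth p ord0) == y)%:R
     + 2^-1 * (val (tnth p ord_max) == y)%:R).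

End FiniteGraphs.

Section RandomWalk.
Context (R : realType) (V : choiceType) (d : measure_display)
  (Omega : measurableType d) (P : probability Omega R).
Variable X : nat -> Omega -> V.

Definition cylinder (x : nat -> V) (n : nat) : set Omega :=
  [set w | forall i, (i <= n)%N -> X i w = x i].

Definition step_prob (H : rel V) (x y : V) : R :=
  if H x y then (degree H x)%:R^-1 else 0.

(* The last condition only matters if V is uncountable or if degrees vanish:
   there, the cylinder probabilities alone might not carry the whole mass. *)
Definition is_simple_random_walk (H : rel V) (v : V) : Prop :=
  [/\ forall n y, measurable [set w | X n w = y],
      P [set w | X 0 w = v] = 1%E,
      forall (x : nat -> V) n,
        P (cylinder x n.+1)
        = (P (cylinder x n) * (step_prob H (x n) (x n.+1))%:E)%E
    & {ae P, forall w, forall n, H (X n w) (X n.+1 w)}].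

Definition return_time (v : V) (w : Omega) : \bar R :=
  ereal_inf [set t%:R%:E | t in [set t : nat | (0 < t)%N /\ X t w = v]].

Definition returns (v : V) : set Omega := [set w | (return_time v w < +oo)%E].

Definition transient (v : V) : Prop := (P (returns v) < 1)%E.

Definition strongly_transient (v : V) : Prop :=
  transient v /\
  ((\int[P]_(w in returns v) return_time v w)
     * ((fine (P (returns v)))^-1)%:E < +oo)%E.

(* Y n is the output of the estimator on the n-step trace: its conditional law
   given the whole walk is Psi_law of the trace. The cylinders of length at
   least n generate the sigma-algebra of the walk. *)
Definition is_Psi_of_trace (Y : nat -> Omega -> V) : Prop :=
  (forall n y, measurable [set w | Y n w = y]) /\
  (forall (x : nat -> V) n m y, (n <= m)%N ->
     P (cylinder x m `&` [set w | Y n w = y])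
     = (P (cylinder x m) * (Psi_law (trace x n) R y)%:E)%E).

End RandomWalk.

(* Main.v *)
Require Import Defs.
From mathcomp Require Import all_boot all_order all_algebra.
From mathcomp Require Import finmap.
From mathcomp Require Import all_classical all_reals all_analysis.
From mathcomp Require Import measurable_realfun.
From mathcomp Require Import zify ring lra.
Set Implicit Arguments.
Unset Strict Implicit.
Unset Printing Implicit Defensive.
Import Order.TTheory GRing.Theory Num.Theory.
Local Open Scope classical_set_scope.
Local Open Scope ring_scope.

(** Why the source is found with positive probability.

    Call a time [s] of a path [x] a cut of width [K] when no vertex visited up
    to [s] is visited at or after time [s + K].  A walk in the trace that leaves
    the vertices visited up to [s] can only do so through an edge traversed
    before time [s + K]; hence cuts that are at least their width apart
    contribute one unit each to the trace distance from [x 0] ([depth_size]).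
    Suppose that every time [t > 0] comes after a cut [s] such that [t - s] is
    at most the number of units collected up to [s].  A geodesic from [x 0] to a
    vertex visited at or after [t] leaves the past of [s] at some [x i] with
    [s < i <= t], and going from [x t] to [x i] is shorter than going from [x 0]
    to [x i].  So [x t] is never an end of a diametrical path unless the other
    end is [x 0] ([extremal_gdist]), and the estimator answers [x 0] with
    probability at least 1/2 ([extremal_Psi]).  Such paths are called extremal.

    A time that is not a cut of width [K] is covered by a loop of length at
    least [K].  The expected total length of the long loops that start at a given
    time is at most the tail of the series of [l * p l], where [p l] is the
    probability of being back after [l] steps; strong transience makes
    this series converge ([strongly_transient_moment], by renewal).  A maximal
    inequality of Hopf's type ([excess_prob]) turns this first moment into
    a bound that holds with probability close to 1 for all initial segments at
    once: the proportion of covered times stays below a prescribed level.  It is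
    used at two scales.  At some width [K], at most a quarter of the times are
    covered, so the depth grows at least like [t / (2 * K)].  At a much larger
    width [K1], the covered proportion is at most [1 / (1000 * K)], so the gaps
    between cuts of width [K1] are small with respect to the depth.
    The path is then extremal except for a bounded number of early times.

    The early times are handled by surgery ([surgery]).  Before a cut [m] the
    path is replaced by a simple path of the trace of [x 0], ..., [x m], which
    becomes a pendant path, longer than the range of the exceptional times.  The
    new path is extremal.  The surgery changes boundedly many steps, so it
    costs a constant factor in probability ([path_mean_surgery_le]);
    it moves the starting point, but being extremal only depends on which times
    visit equal vertices, so by transitivity its probability is the
    same for all starting points ([extremal_path_prob_lower]).

    On the lattice, conditioning on the number of steps along each axis gives
    [p l = O(l^(-d/2))] through a negative moment of the multinomial
    distribution ([lattice_return_le]), and [l * p l] is summable for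
    [d >= 5].

    Expectations of functions of the first [n] steps are finite averages over
    the [n]-step paths; the probability space only appears through cylinders. *)

(** * Cuts of a path and distances in its trace *)
Section Cuts.
Variables (V : choiceType) (x : nat -> V) (n : nat).
Local Open Scope nat_scope.

Definition cut (s K : nat) :=
  forall i j, i <= s -> s + K <= j <= n -> x i <> x j.

(** [depth s c] collects [c] units of distance up to time [s]; the base case is
    the step needed to leave the vertices visited up to [s]. *)
Inductive depth : nat -> nat -> Prop :=
| depth1 s : depth s 1
| depthS s K s' c :
    depth s c -> cut s K -> s + K <= s' -> depth s' c.+1.

Definition extremal :=
  forall t, 0 < t <= n -> exists s K c,
    [/\ cut s K, s + K <= t, depth s c & t - s <= c].

Definition visited (s : nat) : seq V := mkseq x s.+1.

Definition tedge : rel V := subgraph_adj (trace x n).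

Lemma visitedP s y : reflect (exists2 i, i <= s & y = x i) (y \in visited s).
Proof.
apply: (iffP mapP) => -[i].
  by rewrite mem_iota add0n ltnS => /andP[_ lis] ->; exists i.
by move=> lis ->; exists i => //; rewrite mem_iota add0n ltnS.
Qed.

Lemma visited_sub s s' y : s <= s' -> y \in visited s -> y \in visited s'.
Proof.
by move=> ss' /visitedP[i le_is ->]; apply/visitedP; exists i => //; lia.
Qed.

Lemma tedgeP a b :
  reflect (exists2 i, i < n & (a = x i /\ b = x i.+1) \/ (b = x i /\ a = x i.+1))
          (tedge a b).
Proof.
apply: (iffP existsP) => [[i /orP[] /andP[/eqP -> /eqP ->]]|[i lin ab]].
- by exists i => //; left.
- by exists i => //; right.
- exists (Ordinal lin) => /=.
  by case: ab => -[-> ->]; rewrite !eqxx ?orbT.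
Qed.

Lemma tedge_sym : symmetric tedge.
Proof.
by move=> a b; apply/tedgeP/tedgeP => -[i lin ab]; exists i => //; tauto.
Qed.

Lemma tedge_step i : i < n -> tedge (x i) (x i.+1).
Proof. by move=> lin; apply/tedgeP; exists i => //; left. Qed.

Lemma tedge_walk i k : i + k <= n ->
  exists p, [/\ path tedge (x i) p, last (x i) p = x (i + k) & size p = k].
Proof.
elim: k i => [|k IH] i ikn; first by exists [::]; rewrite addn0.
case: (IH i.+1) => [|p [pp lp sp]]; first lia.
exists (x i.+1 :: p); split => /=; last by rewrite sp.
- by rewrite pp andbT; apply: tedge_step; lia.
- by rewrite lp addSnnS.
Qed.

Lemma path_rev_sym (T : eqType) (e : rel T) a p : symmetric e -> path e a p ->
  exists q, [/\ path e (last a p) q, last (last a p) q = a & size q = size p].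
Proof.
move=> es pp; exists (rev (belast a p)); split; last by rewrite size_rev size_belast.
- rewrite rev_path; rewrite -(eq_path (e := e)) //.
- by case: p pp => //= b p _; rewrite rev_cons last_rcons.
Qed.

Lemma tedge_walk_back i k : i <= k -> k <= n ->
  exists p, [/\ path tedge (x k) p, last (x k) p = x i & size p = k - i].
Proof.
move=> ik kn; have [|p [pp lp sp]] := @tedge_walk i (k - i); first lia.
have [q [pq lq sq]] := path_rev_sym tedge_sym pp.
by exists q; rewrite -sp -sq; split => //; move: pq lq; rewrite lp subnKC.
Qed.

(** At or after time [s + K] the path stays outside of the vertices visited up to
    [s], so an edge that leaves them was traversed earlier. *)
Lemma edge_exit s K a b : cut s K -> tedge a b -> a \in visited s ->
  b \notin visited s -> exists2 i, s < i <= s + K & b = x i.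
Proof.
move=> sK /tedgeP[i lin ab] /visitedP[j js aj] bs.
have isK : i < s + K.
  rewrite ltnNge; apply/negP => ski.
  by case: ab => -[e1 e2]; [apply: (sK j i)|apply: (sK j i.+1)] => //; rewrite -?aj //; lia.
have sb k : b = x k -> s < k.
  by move=> bk; rewrite ltnNge; apply: contra bs => ks; apply/visitedP; exists k.
by case: ab => -[e1 e2]; [exists i.+1|exists i] => //; rewrite sb //=; lia.
Qed.

Lemma walk_exit s K a p : cut s K -> a \in visited s -> path tedge a p ->
  last a p \notin visited s ->
  exists p1 i p2, [/\ p = p1 ++ x i :: p2, s < i <= s + K &
                      x i \notin visited s].
Proof.
move=> sK; elim: p a => [|b p IH] a /= as_; first by rewrite as_.
case/andP => ab pp lp.
have [bs|bs] := boolP (b \in visited s).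
  have [p1 [i [p2 [-> i_s xi]]]] := IH b bs pp lp.
  by exists (b :: p1), i, p2.
have [i i_s bi] := edge_exit sK ab as_ bs.
by exists [::], i, p; rewrite -bi.
Qed.

(** A walk leaving the past of [s'] first leaves the past of [s], at a vertex
    visited by time [s + K <= s'], so it still has at least one step to do. *)
Lemma depth_size s c p : depth s c -> path tedge (x 0) p ->
  last (x 0) p \notin visited s -> c <= size p.
Proof.
have v0 s' : x 0 \in visited s' by apply/visitedP; exists 0.
move=> sc; elim: sc p => {s c} [s|s K s' c sc IH sK ss'] p pp lp.
  by case: p pp lp => //=; rewrite v0.
have [|p1 [i [p2 [ep i_s xi]]]] := walk_exit sK (v0 s) pp.
  by apply: contra lp; apply: visited_sub; lia.
move: pp lp; rewrite ep -cat_rcons cat_path last_cat last_rcons => /andP[pp1 pp2] lp.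
have := IH _ pp1; rewrite last_rcons size_cat => /(_ xi) c1.
case: p2 ep lp pp2 => [ep|? ? _ _ _] /=; last by rewrite size_rcons in c1 *; lia.
by case/negP; apply/visitedP; exists i => //; lia.
Qed.

Lemma cut_notin s K j : cut s K -> s + K <= j <= n -> x j \notin visited s.
Proof. by move=> sK jn; apply/visitedP => -[i i_s] /esym; exact: sK. Qed.

Lemma depth_mono s s' c : depth s c -> s <= s' -> depth s' c.
Proof.
case=> {s c} [s _|s K s1 c sc sK ss1 ss']; first exact: depth1.
by apply: (depthS sc sK); lia.
Qed.

End Cuts.

(** * Diametrical paths of the trace of an extremal path *)
Section GraphDistance.
Variables (V : choiceType) (G : subgraph V).
Let T : finType := subgraph_verts G.
Local Open Scope nat_scope.

Lemma has_walkP (a b : T) k :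
  reflect (exists p, [/\ path (@gadj V G) a p, last a p = b & size p = k])
          (has_walk a b k).
Proof.
apply: (iffP existsP) => [[p /andP[pp /eqP lp]]|[p [pp lp sp]]].
  by exists p; rewrite size_tuple.
have sp' : size p == k by rewrite sp.
by exists (Tuple sp'); rewrite /= pp lp eqxx.
Qed.

Lemma gdist_le (a b : T) p :
  path (@gadj V G) a p -> last a p = b -> gdist a b <= size p.
Proof.
move=> pp lp.
have [small|big] := ltnP (size p) #|{: T}|; last first.
  apply: leq_trans big; rewrite /gdist.
  by have := find_size (has_walk a b) (iota 0 #|T|); rewrite size_iota.
rewrite leqNgt; apply/negP => lt.
have := before_find 0 lt; rewrite nth_iota // add0n.
suff -> : has_walk a b (size p) by [].
by apply/has_walkP; exists p.
Qed.

(** A simple walk has fewer steps than there are vertices, so the bounded search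
    that defines [gdist] succeeds on connected pairs. *)
Lemma gdist_walk (a b : T) p : path (@gadj V G) a p -> last a p = b ->
  exists q, [/\ path (@gadj V G) a q, last a q = b & size q = gdist a b].
Proof.
move=> pp lp; apply/has_walkP.
have hs : has (has_walk a b) (iota 0 #|T|).
  case/shortenP: pp lp => q pq uq _ lq; apply/hasP; exists (size q).
    rewrite mem_iota add0n /=.
    by have /card_uniqP := uq; rewrite /= => <-; apply: max_card.
  by apply/has_walkP; exists q.
have := nth_find 0 hs; rewrite nth_iota ?add0n //.
by move: hs; rewrite has_find size_iota.
Qed.

End GraphDistance.

Section Estimator.
Variables (V : choiceType) (x : nat -> V) (n : nat).
Local Notation G := (trace x n).
Let T : finType := subgraph_verts G.
Local Open Scope nat_scope.

Lemma trace_vertsP y : reflect (exists2 i, i <= n & y = x i) (y \in subgraph_verts G).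
Proof.
apply: (iffP idP) => [/imfsetP[i _ ->]|[i lin ->]]; first by exists i => //; rewrite -ltnS.
by apply/imfsetP; exists (Ordinal (lin : i < n.+1)).
Qed.

Lemma tedge_vert a b : tedge x n a b -> b \in subgraph_verts G.
Proof.
case/tedgeP => i lin ab; apply/trace_vertsP.
by case: ab => -[e1 e2]; [exists i.+1|exists i] => //; lia.
Qed.

Lemma gadj_path (a : T) p : path (tedge x n) (val a) p ->
  exists q : seq T, p = map val q /\ path (@gadj V G) a q.
Proof.
elim: p a => [|b p IH] a /=; first by exists [::].
case/andP => ab pp; pose b' : T := [` tedge_vert ab]%fset.
have [q [ep pq]] := IH b' pp.
by exists (b' :: q); rewrite /= -ep pq andbT; split => //.
Qed.

Lemma path_gadj (a : T) q : path (@gadj V G) a q ->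
  path (tedge x n) (val a) (map val q).
Proof. by rewrite path_map. Qed.

Lemma trace_gdist_le (a b : T) p : path (tedge x n) (val a) p ->
  last (val a) p = val b -> gdist a b <= size p.
Proof.
move=> pp; have [q [-> pq]] := gadj_path pp.
by rewrite last_map => /val_inj lq; rewrite size_map; apply: gdist_le.
Qed.

Lemma trace_gdist_walk (a b : T) : exists p,
  [/\ path (tedge x n) (val a) p, last (val a) p = val b & size p = gdist a b].
Proof.
have [i lin ai] := trace_vertsP _ (valP a).
have [j ljn bj] := trace_vertsP _ (valP b).
have [p [pp lp]] : exists p, path (tedge x n) (val a) p /\ last (val a) p = val b.
  rewrite ai bj; have [ij|ji] := leqP i j.
    have [|p [pp lp _]] := @tedge_walk _ x n i (j - i); first lia.
    by exists p; rewrite lp subnKC.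
  have [p [pp lp _]] := tedge_walk_back x (ltnW ji) lin.
  by exists p.
have [q [ep pq]] := gadj_path pp.
move: lp; rewrite ep last_map => /val_inj lq.
have [r [pr lr sr]] := gdist_walk pq lq.
by exists (map val r); rewrite path_gadj // last_map lr size_map.
Qed.

Lemma gdist_sym (a b : T) : gdist a b = gdist b a.
Proof.
wlog suff H : a b / gdist a b <= gdist b a.
  by apply/eqP; rewrite eqn_leq !H.
have [p [pp lp <-]] := trace_gdist_walk b a.
have [q [pq lq <-]] := path_rev_sym (tedge_sym x n) pp.
by rewrite lp in pq lq; apply: trace_gdist_le.
Qed.

Lemma gdist_gdiam (a b : T) : gdist a b <= gdiam G.
Proof.
apply: leq_trans (leq_bigmax (F := fun b => gdist a b) b) _.
exact: (leq_bigmax (F := fun a => \max_b gdist a b) a).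
Qed.

Let root : T := [` (introT (trace_vertsP (x 0)) (ex_intro2 _ _ 0 (leq0n n) erefl)) ]%fset.

Hypothesis ext : extremal x n.

(** Moving the earlier of the two ends to [root] makes the distance larger: the
    cut provided by [ext] forces the geodesic from [root] through some [x k], which
    the earlier end reaches in fewer steps than [root]. *)
Lemma extremal_gdist (a b : T) :
  a != root -> b != root -> gdist a b < gdiam G.
Proof.
have [i lin ai] := trace_vertsP _ (valP a).
have [j ljn bj] := trace_vertsP _ (valP b).
wlog ij : a b i j lin ljn ai bj / i <= j.
  by move=> W aR bR; have [ij|ji] := leqP i j;
     [apply: (W a b i j)|rewrite gdist_sym; apply: (W b a j i) => //; apply: ltnW].
move=> aR _; have i_gt0 : 0 < i.
  by rewrite lt0n; apply: contra aR => /eqP i0; apply/eqP/val_inj; rewrite ai i0.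
have [|s [K [c [sK sKi sc isc]]]] := ext (t := i); first by rewrite i_gt0.
have [p [pp lp sp]] := trace_gdist_walk root b.
have v0 : x 0 \in visited x s by apply/visitedP; exists 0.
have [|p1 [k [p2 [ep ks xk]]]] := walk_exit sK v0 pp.
  by rewrite lp bj; apply: cut_notin sK _; lia.
move: pp lp sp; rewrite ep -cat_rcons cat_path last_cat last_rcons => /andP[pp1 pp2] lp sp.
(* x k is far from root by depth, but at most i - k steps away from x i. *)
have := depth_size sc pp1; rewrite last_rcons => /(_ xk) c1.
apply: leq_trans (gdist_gdiam root b); rewrite -sp size_cat.
have ki : k <= i by lia.
have [q [pq lq sq]] := tedge_walk_back x ki lin.
have : gdist a b <= size (q ++ p2).
  by apply: trace_gdist_le; rewrite ai ?cat_path ?last_cat lq ?lp ?pq ?pp2.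
rewrite size_cat sq size_rcons => ab.
rewrite size_rcons in c1; lia.
Qed.

Lemma gdiam_attained : exists a b : T, gdist a b = gdiam G.
Proof.
have cT : 0 < #|T| by apply/card_gt0P; exists root.
have [a ea] := @bigop.eq_bigmax T (fun a : T => \max_(b : T) gdist a b) cT.
have [b eb] := @bigop.eq_bigmax T (fun b : T => gdist a b) cT.
by exists a, b; rewrite /gdiam ea eb.
Qed.

Lemma diametrical_nonempty : 0 < #|diametrical_paths G|.
Proof.
have [a [b ab]] := gdiam_attained.
have [p [pp lp sp]] := trace_gdist_walk a b.
have [q [ep pq]] := gadj_path pp.
have sz : size (a :: q) == (gdiam G).+1 by rewrite -ab -sp ep size_map /=.
apply/card_gt0P; exists (Tuple sz); rewrite inE /= pq /=.
have -> : tnth (Tuple sz) ord0 = a by [].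
have -> : tnth (Tuple sz) ord_max = b.
  rewrite (tnth_nth a) /=; apply/val_inj; rewrite -lp ep last_map.
  by rewrite (last_nth a); congr (val (nth _ _ _)); case/eqP: (sz).
by rewrite ab.
Qed.

Local Open Scope ring_scope.

Lemma extremal_Psi (R : realType) : 2^-1 <= Psi_law G R (x 0).
Proof.
rewrite /Psi_law; have dp := diametrical_nonempty.
set N := #|_| in dp *.
have N0 : (N%:R : R) != 0 by rewrite pnatr_eq0 -lt0n.
have {1}-> : 2^-1 = \sum_(p in diametrical_paths G) N%:R^-1 * 2^-1 :> R.
  by rewrite sumr_const -mulrnAl -[_^-1 *+ _]mulr_natr mulVf // mul1r.
apply: ler_sum => p; rewrite inE => /andP[_ /eqP dp'].
rewrite ler_pM2l ?invr_gt0 ?ltr0n //.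
have [e1|n1] := eqVneq (tnth p ord0) root.
  by rewrite e1 /= eqxx mulr1 lerDl mulr_ge0 // invr_ge0.
have [e2|n2] := eqVneq (tnth p ord_max) root.
  by rewrite e2 /= eqxx mulr1 lerDr mulr_ge0 // invr_ge0.
by have := extremal_gdist n1 n2; rewrite dp' ltnn.
Qed.

End Estimator.

(** * Loops and the times that they cover *)
Section Covering.
Variables (V : choiceType) (x : nat -> V) (N : nat).
Local Open Scope nat_scope.

Definition loops (K i : nat) : nat :=
  \sum_(l < N.+1) l * [&& K <= l, i + l <= N & x (i + l) == x i].

Definition covered (K t : nat) : bool :=
  [exists i : 'I_t.+1, [exists l : 'I_N.+1,
    [&& t < i + l, K <= l, i + l <= N & x (i + l) == x i]]].

Lemma sum_interval m i l : \sum_(t < m) (i <= t < i + l) <= l.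
Proof.
suff : \sum_(t < m) (i <= t < i + l) <= minn l (m - i) by lia.
elim: m => [|m IH]; first by rewrite big_ord0.
rewrite big_ord_recr /=; move: IH; set S := \sum_(_ < m) _.
by case: (boolP (i <= m < i + l)) => h IH /=; lia.
Qed.

(** A loop of length [l] covers [l] times, so loops weighted by their lengths
    dominate the number of covered times. *)
Lemma sum_covered K m : \sum_(t < m) covered K t <= \sum_(i < m) loops K i.
Proof.
pose Q t i l := [&& i <= t < i + l, K <= l, i + l <= N & x (i + l) == x i].
have cQ (t : 'I_m) : covered K t <= \sum_(i < m) \sum_(l < N.+1) Q t i l.
  case: (boolP (covered K t)) => // /existsP[i /existsP[l H]] /=.
  have im : i < m by have := ltn_ord i; have := ltn_ord t; lia.
  rewrite (bigD1 (Ordinal im)) //= (bigD1 l) //=.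
  suff -> : Q t i l by [].
  by rewrite /Q; case/and4P: H => -> -> -> ->; rewrite !andbT -ltnS ltn_ord.
apply: (@leq_trans (\sum_(t < m) \sum_(i < m) \sum_(l < N.+1) Q t i l)).
  by apply: leq_sum => t _; exact: cQ.
rewrite exchange_big /=; apply: leq_sum => i _.
rewrite exchange_big /=; apply: leq_sum => l _.
case: (boolP [&& K <= l, i + l <= N & x (i + l) == x i]) => H.
  rewrite muln1; apply: leq_trans (sum_interval m i l).
  by apply: leq_sum => t _; rewrite /Q; case: (i <= t < i + l) => //; exact: leq_b1.
by rewrite muln0 leqn0 big1 // => t _; rewrite /Q (negbTE H) andbF.
Qed.

Lemma covered_return K i t j : 0 < K -> i <= t < j -> i + K <= j <= N ->
  x i = x j -> covered K t.
Proof.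
move=> K0 itj ij e; have i1 : i < t.+1 by lia.
have j1 : j - i < N.+1 by lia.
apply/existsP; exists (Ordinal i1); apply/existsP; exists (Ordinal j1) => /=.
rewrite subnKC; last lia.
by rewrite -e eqxx; apply/and4P; split => //; lia.
Qed.

Lemma uncovered_window L K w u :
  (forall m, m <= N -> L * \sum_(i < m) loops K i <= m) ->
  w <= u.+1 <= N -> u.+1 < L * w -> exists2 t, u < t + w <= u + w & ~~ covered K t.
Proof.
move=> H wu Lw.
have [/existsP[t] ct|/existsPn ct] := boolP [exists t : 'I_w, ~~ covered K (u.+1 - w + t)].
  by exists (u.+1 - w + t) => //; have := ltn_ord t; lia.
have : L * \sum_(i < u.+1) covered K i <= u.+1.
  apply: leq_trans (H u.+1 _); last lia.
  by rewrite leq_mul2l sum_covered orbT.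
rewrite -(big_mkord xpredT (fun i => covered K i : nat)).
rewrite (@big_cat_nat _ _ _ (u.+1 - w)) //=; last lia.
have -> : \sum_(u.+1 - w <= i < u.+1) covered K i = w.
  rewrite (big_addn 0 u.+1 (u.+1 - w)) subKn; last lia.
  rewrite (eq_big_nat _ _ (F2 := fun=> 1)); first by rewrite sum_nat_const_nat subn0 muln1.
  move=> i iw; have := ct (Ordinal (iw : i < w)); rewrite negbK /= addnC => -> //.
rewrite mulnDr; lia.
Qed.

(** If some time of the block [a + j * K, a + (j + 1) * K) is uncovered, then the
    first time of the block is a cut of width [K], since a loop jumping over the
    whole block would cover all its times.  Working with blocks gives cuts that
    are [K] apart. *)
Definition good_block K a j : bool := has (fun t => ~~ covered K t) (iota (a + j * K) K).

Lemma good_block_ne K a j i k : 0 < K -> good_block K a j ->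
  i <= a + j * K -> a + j * K + K <= k <= N -> x i <> x k.
Proof.
move=> K0 /hasP[t]; rewrite mem_iota => tb ct i1 k1 e.
by case/negP: ct; apply: (covered_return (i := i) (j := k)) => //; lia.
Qed.

Lemma sum_bad_block K a J :
  K * \sum_(j < J) ~~ good_block K a j <= \sum_(t < a + J * K) covered K t.
Proof.
elim: J => [|J IH]; first by rewrite big_ord0 muln0.
rewrite big_ord_recr /= mulnDr.
have -> : a + J.+1 * K = a + J * K + K by lia.
rewrite big_split_ord /=; apply: leq_add => //.
case: (boolP (good_block K a J)) => gb; rewrite ?muln0 ?muln1 //=.
rewrite (eq_bigr (fun=> 1)) ?sum1_card ?card_ord // => i _.
have /hasPn/(_ (a + J * K + i)) := gb.
by rewrite /= negbK mem_iota => -> //; have := ltn_ord i; lia.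
Qed.

Lemma sum_good_block K a J : 0 < K ->
  (forall m, m <= N -> 4 * \sum_(i < m) loops K i <= m) ->
  a + J * K <= N -> 3 * (J * K) <= 4 * (K * \sum_(j < J) good_block K a j) + a.
Proof.
move=> K0 H aN.
have e : \sum_(j < J) good_block K a j + \sum_(j < J) ~~ good_block K a j = J.
  rewrite -big_split /= (eq_bigr (fun=> 1)) ?sum1_card ?card_ord // => j _.
  by case: good_block.
have := sum_bad_block K a J; have := sum_covered K (a + J * K); have := H _ aN.
move: e; set g := \sum_(j < J) good_block _ _ _; set b := \sum_(j < J) ~~ _ => e; nia.
Qed.

End Covering.

Section Depth.
Variables (V : choiceType).
Local Open Scope nat_scope.

Lemma depth_blocks (x : nat -> V) n A c K J (good : pred nat) : depth x n A c ->
  (forall j, j < J -> good j -> cut x n (A + j * K) K) ->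
  depth x n (A + J * K) (c + \sum_(j < J) good j).
Proof.
move=> d; elim: J => [|J IH] H; first by rewrite big_ord0 !addn0.
have := IH (fun j jJ => H j (ltnW jJ)); rewrite big_ord_recr /= => dJ.
case: (boolP (good J)) => gJ; last by rewrite addn0; apply: depth_mono dJ _; lia.
by rewrite addn1 addnS; apply: depthS dJ (H J _ gJ) _ => //; lia.
Qed.

(** Extremality only depends on the coincidences between times, and fewer
    coincidences are better. *)
Lemma extremal_pattern (W : choiceType) (x : nat -> V) (y : nat -> W) n :
  (forall i j, i <= n -> j <= n -> y i = y j -> x i = x j) ->
  extremal x n -> extremal y n.
Proof.
move=> xy ext.
have cxy s K : cut x n s K -> cut y n s K.
  by move=> H i j i1 j1 /xy => e; apply: (H i j) => //; apply: e; lia.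
have dxy s c : depth x n s c -> depth y n s c.
  by elim=> {s c} [s|s K s' c _ IH /cxy sK]; [exact: depth1|exact: depthS IH sK].
move=> t /ext[s [K [c [h1 h2 h3 h4]]]].
by exists s, K, c; split => //; [exact: cxy|exact: dxy].
Qed.

End Depth.

(** * Surgery: replacing the beginning by a pendant path *)
Section Surgery.
Variables (V : choiceType) (x : nat -> V) (N : nat).
Local Open Scope nat_scope.

Lemma tedge_sub m : m <= N -> subrel (tedge x m) (tedge x N).
Proof.
by move=> mN a b /tedgeP[i im ab]; apply/tedgeP; exists i => //; apply: leq_trans mN.
Qed.

Lemma tedge_path_visited m a p : path (tedge x m) a p -> {subset p <= visited x m}.
Proof.
elim: p a => //= b p IH a /andP[/tedgeP[i im ab] pp] y.
rewrite inE => /orP[/eqP ->|]; last exact: IH pp y.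
apply/visitedP; case: ab => -[e1 e2]; [exists i.+1|exists i] => //; exact: ltnW.
Qed.

(** If [x 0] and [x m] are [2 * k] apart, one of them is at distance at least [k]
    from [x i]. *)
Lemma long_simple_path m k i : i <= m ->
  (forall p, path (tedge x m) (x 0) p -> last (x 0) p = x m -> k + k <= size p) ->
  exists z, [/\ path (tedge x m) (x i) z, uniq (x i :: z) & size z = k].
Proof.
move=> im far.
have cut_path p : path (tedge x m) (x i) p -> uniq (x i :: p) -> k <= size p ->
  exists z, [/\ path (tedge x m) (x i) z, uniq (x i :: z) & size z = k].
  move=> pp up kp; exists (take k p); split; last by rewrite size_takel.
    by move: pp; rewrite -{1}(cat_take_drop k p) cat_path => /andP[].
  by move: up; rewrite -{1}(cat_take_drop k p) -cat_cons cat_uniq => /andP[].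
have [p0 [pp0 lp0 _]] := tedge_walk_back x (leq0n i) im.
have [|p1 [pp1 lp1 _]] := @tedge_walk _ x m i (m - i); first lia.
rewrite subnKC // in lp1.
case/shortenP: pp0 lp0 => q0 pq0 uq0 _ lq0.
case/shortenP: pp1 lp1 => q1 pq1 uq1 _ lq1.
have [k0|k0] := leqP k (size q0); first exact: cut_path k0.
have [k1|k1] := leqP k (size q1); first exact: cut_path k1.
have [r [pr lr sr]] := path_rev_sym (tedge_sym x m) pq0.
have := far (r ++ q1); rewrite cat_path last_cat size_cat.
rewrite lq0 in pr lr; rewrite lr pr pq1 lq1 sr => /(_ isT erefl) kk.
by have := leq_ltn_trans kk (leq_add k0 (ltnW k1)); rewrite ltnn.
Qed.

(** The path [z], traversed backwards down to its origin [x a], followed by [x]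
    from time [a] on.  Time [R + S] of the new path is time [a + S] of [x]. *)
Definition surgered (a R n : nat) (z : seq V) : nat -> V :=
  fun i => if i < R then nth (x a) z (R.-1 - i) else x (a + (i - R)).

Section Surgered.
Variables (a m R n : nat) (z : seq V).
Local Notation X := (surgered a R n z).
Hypotheses (sz : size z = R) (uz : uniq (x a :: z)) (zm : {subset z <= visited x m}).
Hypotheses (afresh : forall i, a < i <= N -> x i \notin visited x m).
Hypotheses (Rn : R <= n) (anN : a + (n - R) <= N).

Lemma surgered_pendant i j : i < R -> i < j <= n -> X i <> X j.
Proof.
move=> iR ij; rewrite /surgered iR => e.
have zi : nth (x a) z (R.-1 - i) \in z by apply: mem_nth; rewrite sz; lia.
case: (ltnP j R) e => jR e.
  move/eqP: e; rewrite nth_uniq ?sz; [|lia|lia|by case/andP: uz].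
  by move/eqP; lia.
have [e0|aj] := posnP (j - R).
  by move: uz; rewrite /= -{1}(addn0 a) -e0 -e zi.
have : x (a + (j - R)) \notin visited x m by apply: afresh; lia.
by rewrite -e => /negP; apply; apply: zm.
Qed.

Lemma surgered_cut_pendant i : i < R -> cut X n i 1.
Proof. by move=> iR k j ki ij; apply: surgered_pendant; lia. Qed.

Lemma surgered_depth_pendant i : i <= R -> depth X n i i.+1.
Proof.
elim: i => [|i IH] iR; first exact: depth1.
by apply: (depthS (IH (ltnW iR)) (surgered_cut_pendant iR)); lia.
Qed.

Lemma surgered_cut S K :
  (forall i j, i <= a + S -> a + S + K <= j <= N -> x i <> x j) ->
  cut X n (R + S) K.
Proof.
move=> H i j i1 j1; have [S0|S0] := ltnP n (R + S + K); first lia.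
have [iR|iR] := ltnP i R.
  have [ij|ij] := ltnP i j; first by apply: surgered_pendant; lia.
  lia.
rewrite /surgered ifF; last lia.
rewrite ifF; last lia.
by apply: H; lia.
Qed.

Variables (K K1 : nat).
Hypotheses (K_gt0 : 0 < K) (K1_gt0 : 0 < K1).
Hypothesis loopsK : forall k, k <= N -> 4 * \sum_(i < k) loops x N K i <= k.
Hypothesis loopsK1 :
  forall k, k <= N -> (1000 * K) * \sum_(i < k) loops x N K1 i <= k.
Hypotheses (RK : K <= R) (RK1 : 4 * K1 <= R) (aR : a <= 9 * (K * R)).

(** The pendant path gives [R + 1] units of depth; the good blocks between times
    [a] and [a + S] of [x] give the rest. *)
Lemma surgered_depth S : a + S <= N ->
  exists2 c, depth X n (R + S) (R.+1 + c) &
    3 * S <= 4 * (K * c) + 3 * K + a.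
Proof.
move=> aSN; exists (\sum_(j < S %/ K) good_block x N K a j).
  apply: (@depth_mono _ _ _ (R + S %/ K * K)); last by rewrite leq_add2l leq_divM.
  apply: depth_blocks; first exact: surgered_depth_pendant.
  move=> j _ gb; apply: surgered_cut => i k i1 k1.
  exact: (good_block_ne K_gt0 gb).
have := divn_eq S K; have := ltn_pmod S K_gt0.
have := @sum_good_block _ x N K a (S %/ K) K_gt0 loopsK.
move: (S %/ K) (S %% K) => J r; set g := \sum_(_ < _) _ => H r1 e.
have : a + J * K <= N by lia.
move/H; lia.
Qed.

(** Up to time [2 * R] the cuts of the pendant path suffice.  Later, [T = t - R]
    steps after the surgery, a window of [w] times contains a cut of width [K1],
    where [w] is about [(a + T) / (1000 * K)].  While [T <= 50 * K * R],
    the length [R] of the pendant path exceeds [K1 + w]; beyond, the depth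
    has had the time to grow linearly with slope of order [1 / K]. *)
Lemma surgered_extremal : extremal X n.
Proof.
move=> t /andP[t0 tn].
have [tR|tR] := leqP t R.
  exists t.-1, 1, t; split; [|lia| |lia].
    by apply: surgered_cut_pendant; lia.
  by rewrite -{2}(prednK t0); apply: surgered_depth_pendant; lia.
have [tR2|tR2] := ltnP t (R + R).
  exists R.-1, 1, R; split; [|lia| |lia].
    by apply: surgered_cut_pendant; lia.
  by have := @surgered_depth_pendant R.-1 (leq_pred _); rewrite prednK //; lia.
pose T := t - R; pose w := ((a + T) %/ (1000 * K)).+1.
have RT : R <= T by rewrite /T; lia.
have L0 : 0 < 1000 * K by lia.
have wlo : a + T < (1000 * K) * w by rewrite /w mulnC ltn_ceil.
have whi : (1000 * K) * w <= a + T + 1000 * K.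
  by rewrite /w mulnS addnC leq_add2r mulnC leq_divM.
have KRT : K * R <= K * T by rewrite leq_mul2l RT orbT.
have TK : T <= K * T by apply: leq_pmull.
have w100 : 100 * w <= T + 100.
  by rewrite -(leq_pmul2l K_gt0); lia.
have [||s s1 cs] := uncovered_window (w := w) (u := a + T - K1) loopsK1; [lia|lia|].
have sa : a <= s by lia.
have [c dc c1] := @surgered_depth (s - a) ltac:(lia).
exists (R + (s - a)), K1, (R.+1 + c); split => //; [|lia|].
  apply: surgered_cut => i j i1 j1 e.
  by case/negP: cs; apply: (covered_return (i := i) (j := j)) => //; lia.
have [Tsmall|Tbig] := leqP T (50 * (K * R)).
  have : 1000 * w <= 59 * R + 1000 by rewrite -(leq_pmul2l K_gt0); lia.
  lia.
have : K * (K1 + w) <= K * (R.+1 + c); last by rewrite leq_pmul2l //; lia.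
have KR4 : K * (4 * K1) <= K * R by rewrite leq_mul2l RK1 orbT.
have KKR : K <= K * R by apply: leq_pmulr; lia.
lia.
Qed.

End Surgered.

Variables (K K1 R n : nat).
Hypotheses (K_gt0 : 0 < K) (K1_gt0 : 0 < K1).
Hypothesis loopsK : forall k, k <= N -> 4 * \sum_(i < k) loops x N K i <= k.
Hypothesis loopsK1 :
  forall k, k <= N -> (1000 * K) * \sum_(i < k) loops x N K1 i <= k.
Hypotheses (RK : K <= R) (RK1 : 4 * K1 <= R) (Rn : R <= n).
Hypothesis eN : N = 9 * (K * R) + n.

Lemma surgery : exists a z, [/\ a < 9 * (K * R), size z = R,
  path (tedge x N) (x a) z & extremal (surgered a R n z) n].
Proof.
have KKR : K <= K * R by apply: leq_pmulr; lia.
(* At most a quarter of the first 8 K R times are covered, so some m in the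
   second half is not. *)
have [||m m1 cm] := uncovered_window (w := 4 * (K * R)) (u := (8 * (K * R)).-1) loopsK.
- lia.
- lia.
have mcut : cut x N m K.
  move=> i j i1 j1 e; case/negP: cm.
  by apply: (covered_return (i := i) (j := j)) => //; lia.
have far p : path (tedge x m) (x 0) p -> last (x 0) p = x m -> R + R <= size p.
  move=> pp lp.
  have [|q [pq lq sq]] := @tedge_walk _ x N m K; first lia.
  have d : depth x N (0 + 4 * R * K) (1 + \sum_(j < 4 * R) good_block x N K 0 j).
    apply: depth_blocks; first exact: depth1.
    by move=> j _ gb i k i1 k1; apply: (good_block_ne K_gt0 gb); lia.
  have := @sum_good_block _ x N K 0 (4 * R) K_gt0 loopsK ltac:(lia).
  have dm := depth_mono (s' := m) d ltac:(lia).
  have := depth_size (p := p ++ q) dm; rewrite cat_path last_cat size_cat lp lq pq.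
  rewrite (sub_path (tedge_sub _) pp); last lia.
  have nv : x (m + K) \notin visited x m by apply: (cut_notin mcut); lia.
  move=> /(_ isT nv); set g := \sum_(_ < _) _ => h1 h2.
  have : 3 * (4 * R) <= 4 * g by rewrite -(leq_pmul2r K_gt0); lia.
  lia.
(* The last visit to the past of m, so that x is fresh after time a. *)
have [a [[am amK av] afresh]] : exists a, [/\ m <= a, a < m + K & x a \in visited x m] /\
    (forall i, a < i <= N -> x i \notin visited x m).
  pose P a := [&& m <= a, a < m + K & x a \in visited x m].
  have exP : exists a, P a.
    by exists m; rewrite /P leqnn; apply/andP; split => //; apply/andP; split;
      [lia|apply/visitedP; exists m].
  have ubP a : P a -> a <= m + K by case/and3P => _ /ltnW.
  case: (ex_maxnP exP ubP) => a /and3P[h1 h2 h3] amax; exists a; split => // i i1.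
  have [imK|imK] := ltnP i (m + K); last by apply: (cut_notin mcut); lia.
  apply/negP => xi; have := amax i; rewrite /P imK xi !andbT => /(_ _); lia.
have [i im ai] := visitedP _ _ _ av.
have [z [pz uz sz]] := long_simple_path im far.
rewrite -ai in pz uz.
have mR : m < 8 * (K * R) by lia.
exists a, z; split => //; first lia.
  by apply: sub_path pz; apply: tedge_sub; lia.
apply: (surgered_extremal sz uz (tedge_path_visited pz) afresh) K_gt0 K1_gt0
  loopsK loopsK1 _ _ _ => //; lia.
Qed.

End Surgery.

(** * Averages over the paths of a regular graph *)
Section PathAverages.
Variables (R : realType) (V : choiceType) (H : rel V) (D : nat).

Definition nbrs (x : V) : seq V := fset_set [set y | H x y].

Fixpoint paths (n : nat) (x : V) : seq (seq V) :=
  if n is m.+1 then [seq x :: s | y <- nbrs x, s <- paths m y] else [:: [:: x]].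

Definition path_mean (n : nat) (x : V) (f : seq V -> R) : R :=
  D%:R^-1 ^+ n * \sum_(s <- paths n x) f s.

Hypothesis (lfH : locally_finite H).

Lemma mem_nbrs x y : (y \in nbrs x) = H x y.
Proof. by rewrite /nbrs in_fset_set ?inE //; exact: asboolb. Qed.

Lemma nbrs_uniq x : uniq (nbrs x).
Proof. exact: fset_uniq. Qed.

Lemma mem_paths n x s : reflect (exists w, [/\ s = x :: w, path H x w & size w = n])
  (s \in paths n x).
Proof.
elim: n x s => [|n IH] x s.
  rewrite inE; apply: (iffP eqP) => [->|[w [-> _ /size0nil ->]]] //.
  by exists [::].
apply: (iffP allpairsPdep) => [[y [t [xy /IH[w [-> pw sw]] ->]]]|[w [-> pw sw]]].
  by exists (y :: w); rewrite /= -mem_nbrs xy pw sw.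
case: w pw sw => //= y w /andP[xy pw] [sw]; exists y, (y :: w).
by split; [rewrite mem_nbrs|apply/IH; exists w|].
Qed.

Lemma paths_uniq n x : uniq (paths n x).
Proof.
elim: n x => [|n IH] x //=.
apply: allpairs_uniq_dep => [|y _|]; [exact: nbrs_uniq|exact: IH|].
move=> [y s] [z t] /allpairsPdep[y1 [s1 [_ ms e1]]] /allpairsPdep[z1 [t1 [_ mt e2]]] /=.
case: e1 => ? ?; case: e2 => ? ?; subst y1 z1; subst => -[] e; subst.
by case/mem_paths: ms => w [-> _ _] in mt *; case/mem_paths: mt => w' [[-> _]].
Qed.

Lemma perm_nbrs_map (phi : V -> V) x : bijective phi ->
  (forall a b, H (phi a) (phi b) = H a b) ->
  perm_eq (nbrs (phi x)) (map phi (nbrs x)).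
Proof.
move=> bphi Hphi; have iphi := bij_inj bphi.
apply: uniq_perm; rewrite ?map_inj_uniq ?nbrs_uniq //.
by case: bphi => psi phiK psiK y; rewrite -[y]psiK mem_map ?mem_nbrs ?Hphi.
Qed.

Lemma path_mean0 x f : path_mean 0 x f = f [:: x].
Proof. by rewrite /path_mean expr0 mul1r big_seq1. Qed.

Lemma path_meanS n x f :
  path_mean n.+1 x f = D%:R^-1 * \sum_(y <- nbrs x) path_mean n y (fun s => f (x :: s)).
Proof.
rewrite /path_mean /= big_allpairs_dep /= exprS -mulrA; congr (_ * _).
by rewrite mulr_sumr.
Qed.

Lemma Dexp_ge0 n : 0 <= D%:R^-1 ^+ n :> R.
Proof. by rewrite exprn_ge0 // invr_ge0. Qed.

Lemma path_mean_le n x f g :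
  (forall w, path H x w -> size w = n -> f (x :: w) <= g (x :: w)) ->
  path_mean n x f <= path_mean n x g.
Proof.
move=> fg; rewrite /path_mean ler_wpM2l ?Dexp_ge0 // big_seq [leRHS]big_seq.
by apply: ler_sum => s /mem_paths[w [-> pw sw]]; exact: fg.
Qed.

Lemma path_mean_eq n x f g :
  (forall w, path H x w -> size w = n -> f (x :: w) = g (x :: w)) ->
  path_mean n x f = path_mean n x g.
Proof.
by move=> fg; apply/eqP; rewrite eq_le !path_mean_le // => w pw sw; rewrite fg.
Qed.

Lemma path_meanD n x f g : path_mean n x (fun s => f s + g s) = path_mean n x f + path_mean n x g.
Proof. by rewrite /path_mean big_split mulrDr. Qed.

Lemma path_meanZ n x c f : path_mean n x (fun s => c * f s) = c * path_mean n x f.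
Proof. by rewrite /path_mean -mulr_sumr mulrCA. Qed.

Lemma path_mean_sum (I : Type) (r : seq I) (P : pred I) n x (f : I -> seq V -> R) :
  path_mean n x (fun s => \sum_(i <- r | P i) f i s) = \sum_(i <- r | P i) path_mean n x (f i).
Proof. by rewrite /path_mean exchange_big /= mulr_sumr. Qed.

Lemma path_mean_ge0 n x f : (forall s, 0 <= f s) -> 0 <= path_mean n x f.
Proof. by move=> f0; rewrite mulr_ge0 ?Dexp_ge0 ?sumr_ge0. Qed.

Lemma path_mean_exchange n x m y (f : seq V -> seq V -> R) :
  path_mean n x (fun s => path_mean m y (f s)) = path_mean m y (fun t => path_mean n x (f ^~ t)).
Proof.
rewrite /path_mean -!mulr_sumr mulrCA exchange_big /=; congr (_ * _).
Qed.

Lemma path_mean_markov n m x f : path_mean (n + m) x f =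
  path_mean n x (fun s => path_mean m (last x s) (fun t => f (s ++ behead t))).
Proof.
elim: n x f => [|n IH] x f.
  by rewrite path_mean0 /=; apply: path_mean_eq => w _ _.
rewrite addSn !path_meanS; congr (_ * _); apply: eq_bigr => y _.
by rewrite IH; apply: path_mean_eq => w _ _.
Qed.

(** Prescribing the first [size w] steps costs a factor [D ^ size w]. *)
Lemma path_mean_prefix_path m y w f : (forall s, 0 <= f s) -> path H y w -> (0 < D)%N ->
  path_mean m (last y w) (fun t => f (belast y w ++ t)) <=
  D%:R ^+ size w * path_mean (size w + m) y f.
Proof.
move=> + + D0; elim: w y f => [|z w IH] y f f0 /=; first by rewrite expr0 mul1r.
case/andP => yz pw; rewrite addSn path_meanS exprSr -mulrA mulVKf ?pnatr_eq0 -?lt0n //.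
apply: le_trans (IH z (fun s => f (y :: s)) _ pw) _ => //.
rewrite ler_wpM2l ?exprn_ge0 // (big_rem z) ?mem_nbrs //= lerDl.
by apply: sumr_ge0 => u _; apply: path_mean_ge0.
Qed.

Hypothesis (D_gt0 : (0 < D)%N) (degH : forall x, degree H x = D).

Lemma size_nbrs x : size (nbrs x) = D.
Proof. by rewrite -(degH x). Qed.

Lemma path_mean_cst n x c : path_mean n x (fun=> c) = c.
Proof.
elim: n x => [|n IH] x; first by rewrite path_mean0.
rewrite path_meanS (eq_bigr (fun=> c)) // big_const_seq count_predT size_nbrs iter_addr_0.
by rewrite -[c *+ D]mulr_natl mulKf // pnatr_eq0 -lt0n.
Qed.

Lemma path_mean_prefix n m x f :
  (forall s t, size s = n.+1 -> f (s ++ t) = f s) -> path_mean (n + m) x f = path_mean n x f.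
Proof.
move=> fp; rewrite path_mean_markov; apply: path_mean_eq => w pw sw.
rewrite -[RHS](path_mean_cst m (last x (x :: w))); apply: path_mean_eq => t _ _.
by rewrite fp //= sw.
Qed.

Lemma path_mean_map (phi : V -> V) n x f : bijective phi ->
  (forall a b, H (phi a) (phi b) = H a b) ->
  path_mean n (phi x) f = path_mean n x (fun s => f (map phi s)).
Proof.
move=> bphi Hphi; elim: n x f => [|n IH] x f; first by rewrite !path_mean0.
rewrite !path_meanS; congr (_ * _).
rewrite (perm_big _ (perm_nbrs_map _ bphi Hphi)) big_map.
by apply: eq_bigr => y _; rewrite IH.
Qed.

(** Functions of a path that only depend on the coincidences between times; by
    transitivity their averages do not depend on the starting point. *)
Definition shape_invariant (T : Type) (f : seq V -> T) :=
  forall phi s, injective phi -> f (map phi s) = f s.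

Hypothesis trH : vertex_transitive H.

Lemma path_mean_shape n x y f : shape_invariant f -> path_mean n x f = path_mean n y f.
Proof.
move=> sf; have [phi [bphi Hphi <-]] := trH y x.
by rewrite path_mean_map //; apply: path_mean_eq => w _ _; rewrite sf //; apply: bij_inj.
Qed.

End PathAverages.

(** * The maximal inequality for loops *)
Section Excess.
Variable V : choiceType.
Local Open Scope nat_scope.

Definition returns_at (l : nat) (s : seq V) : bool :=
  if s is h :: _ then (l < size s) && (nth h s l == h) else false.

Definition loopsum (K : nat) (s : seq V) : nat :=
  \sum_(l < size s) l * (K <= l) * returns_at l s.

(** The largest value of [L * (loopsum of the first N suffixes) - N] over all
    [N]; it is 0 exactly when the weighted loops never exceed the
    proportion [1 / L].  The recursion is that of the waiting time in a queue,
    truncated subtraction playing the role of the maximum with 0. *)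
Fixpoint excess (L K : nat) (s : seq V) : nat :=
  if s is _ :: s' then (L * loopsum K s + excess L K s').-1 else 0.

Lemma returns_at_shape l : shape_invariant (returns_at l).
Proof.
move=> phi [|h s] ip //=; rewrite size_map; case: ltnP => //= ls.
by rewrite -map_cons (nth_map h) // (inj_eq ip).
Qed.

Lemma loopsum_shape K : shape_invariant (loopsum K).
Proof.
by move=> phi s ip; rewrite /loopsum size_map; apply: eq_bigr => l _; rewrite returns_at_shape.
Qed.

Lemma excess_shape L K : shape_invariant (excess L K).
Proof.
move=> phi s ip; elim: s => //= h s ->; congr (_ * _ + _).-1.
exact: (loopsum_shape K (h :: s) ip).
Qed.

Lemma returns_at_cat l s t : l < size s -> returns_at l (s ++ t) = returns_at l s.
Proof.
case: s => //= h s ls; rewrite size_cat -cat_cons nth_cat /= ls.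
by rewrite (_ : l < (size s + size t).+1) //; lia.
Qed.

Lemma loopsum_big K s m : size s <= m ->
  loopsum K s = \sum_(l < m) l * (K <= l) * returns_at l s.
Proof.
move=> sm; rewrite /loopsum (big_ord_widen _ (fun l => l * (K <= l) * returns_at l s) sm).
rewrite [RHS](bigID (fun l : 'I_m => l < size s)) /= [X in _ = _ + X]big1 ?addn0 // => l ls.
by rewrite /returns_at; case: s sm ls => [|h s] sm ls; rewrite ?(negbTE ls) muln0.
Qed.

Lemma loopsum_cat K s t : loopsum K s <= loopsum K (s ++ t).
Proof.
rewrite (@loopsum_big K s (size (s ++ t))); last by rewrite size_cat leq_addr.
rewrite [X in _ <= X]/loopsum.
apply: leq_sum => l _; rewrite leq_mul2l.
have [ls|ls] := ltnP l (size s); first by rewrite returns_at_cat // leqnn orbT.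
suff -> : returns_at l s = false by rewrite orbT.
by move: (nat_of_ord l) ls; case: (s) => //= h s' k sk; rewrite ltnNge sk.
Qed.

Lemma excess_cat L K s t : excess L K s <= excess L K (s ++ t).
Proof.
elim: s => //= h s IH.
have := loopsum_cat K (h :: s) t; rewrite -!subn1 => lc.
by apply: leq_sub2r; apply: leq_add => //; rewrite leq_mul2l lc orbT.
Qed.

Lemma excess_bound L K s m : m <= size s ->
  L * \sum_(i < m) loopsum K (drop i s) <= m + excess L K s.
Proof.
elim: m s => [|m IH] s ms; first by rewrite big_ord0 muln0.
case: s ms => [|h s] //= ms; rewrite big_ord_recl /= mulnDr.
rewrite (eq_bigr (fun i : 'I_m => loopsum K (drop i s))) //.
apply: leq_trans (leq_add (leqnn _) (IH s ms)) _; lia.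
Qed.

Lemma excess_drift L K h s :
  excess L K (h :: s) + (0 < excess L K (h :: s)) <= L * loopsum K (h :: s) + excess L K s.
Proof. by rewrite /=; case: (L * _ + _) => [|[|k]] //=; lia. Qed.

Lemma loops_loopsum v0 (s : seq V) K N i : size s = N.+1 -> i <= N ->
  loops (nth v0 s) N K i = loopsum K (drop i s).
Proof.
move=> ss iN; rewrite (@loopsum_big K _ N.+1); last by rewrite size_drop; lia.
apply: eq_bigr => l _; rewrite -mulnA; congr (_ * _); rewrite mulnb; congr nat_of_bool.
congr (_ && _).
have st : size (drop i s) = N.+1 - i by rewrite size_drop ss.
have nt k : nth v0 (drop i s) k = nth v0 s (i + k) by rewrite nth_drop.
have := nt 0; rewrite addn0 -(nt l) => <-; case: (drop i s) st => [|h t] /= st; first lia.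
case: (ltnP l) => lt; last by rewrite (_ : i + l <= N = false) //; lia.
rewrite (_ : i + l <= N) /=; last lia.
by rewrite (set_nth_default v0).
Qed.

End Excess.

Section Maximal.
Variables (R : realType) (V : choiceType) (H : rel V) (D : nat).
Hypotheses (lfH : locally_finite H) (D_gt0 : (0 < D)%N).
Hypotheses (degH : forall x, degree H x = D) (trH : vertex_transitive H).
Local Notation mean := (@path_mean R V H D).

Definition return_prob (x : V) (l : nat) : R := mean l x (fun s => (returns_at l s)%:R).

Lemma return_prob_ge0 x l : 0 <= return_prob x l.
Proof. exact: path_mean_ge0. Qed.

Lemma path_mean_returns_at o n x l : (l <= n)%N ->
  mean n x (fun s => (returns_at l s)%:R) = return_prob o l.
Proof.
move=> ln; rewrite -(subnKC ln) (path_mean_prefix lfH D_gt0 degH) => [|s t sl].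
  by apply: path_mean_shape => // phi s ip; rewrite returns_at_shape.
by rewrite returns_at_cat // sl.
Qed.

Lemma path_mean_loopsum o n x K : mean n x (fun s => (loopsum K s)%:R) =
  \sum_(l < n.+1) (l * (K <= l))%:R * return_prob o l.
Proof.
rewrite (path_mean_eq _ lfH
  (g := fun s => \sum_(l < n.+1) (l * (K <= l))%:R * (returns_at l s)%:R)).
  rewrite path_mean_sum; apply: eq_bigr => l _.
  by rewrite path_meanZ (path_mean_returns_at o) // -ltnS.
move=> w _ sw; rewrite (@loopsum_big _ K _ n.+1) /= ?sw // natr_sum.
by apply: eq_bigr => l _; rewrite natrM.
Qed.

(** Hopf's argument.  The mean of the excess does not depend on the starting
    point and grows with the horizon, so prepending one step, which adds [L]
    times the loops of the new starting point and subtracts 1 if the result is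
    positive, cannot decrease the mean; this bounds the probability that 1 is
    subtracted, hence that the excess is positive. *)
Lemma excess_prob o L K n x : mean n x (fun s => (0 < excess L K s)%N%:R) <=
  L%:R * \sum_(l < n.+1) (l * (K <= l))%:R * return_prob o l.
Proof.
case: n => [|n].
  rewrite path_mean0 /= /loopsum big_ord1 /= mul0n muln0 mulr0n.
  by rewrite mulr_ge0 // sumr_ge0 // => l _; rewrite mulr_ge0 // return_prob_ge0.
pose e m y := mean m y (fun s => (excess L K s)%:R).
have e_indep m y z : e m y = e m z.
  by apply: path_mean_shape => // phi s ip; rewrite excess_shape.
have e_tail : mean n.+1 x (fun s => (excess L K (behead s))%:R) = e n x.
  rewrite path_meanS /= (eq_bigr (fun=> e n x)) => [|y _]; last exact: e_indep.
  rewrite big_const_seq count_predT (size_nbrs degH) iter_addr_0.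
  by rewrite -[e n x *+ D]mulr_natl mulKf // pnatr_eq0 -lt0n.
(* A longer horizon only adds loops. *)
have e_mono : e n x <= e n.+1 x.
  rewrite {2}/e -addn1 path_mean_markov //.
  rewrite /e; apply: (path_mean_le _ lfH) => w pw sw.
  rewrite -[leLHS](path_mean_cst D_gt0 degH 1 (last x (x :: w))).
  by apply: (path_mean_le _ lfH) => t _ _; rewrite ler_nat excess_cat.
have : e n.+1 x + mean n.+1 x (fun s => (0 < excess L K s)%N%:R) <=
    L%:R * (\sum_(l < n.+2) (l * (K <= l))%:R * return_prob o l) + e n x.
  rewrite -(path_mean_loopsum o n.+1 x K) -e_tail -path_meanZ -!path_meanD.
  apply: (path_mean_le _ lfH) => w _ _.
  by rewrite -natrM -!natrD ler_nat; apply: excess_drift.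
lra.
Qed.

End Maximal.

(** * Probability of an extremal path *)
Section Target.
Variables (V : choiceType) (H : rel V).

Definition extremal_path (s : seq V) : bool :=
  if s is h :: _ then `[< extremal (nth h s) (size s).-1 >] else false.

Lemma extremal_path_shape : shape_invariant extremal_path.
Proof.
move=> phi [|h s] ip //=; rewrite size_map -map_cons.
apply/asbool_equiv_eq; split; apply: extremal_pattern => i j i1 j1.
  by rewrite (nth_map h) // (nth_map h) // => ->.
by rewrite (nth_map h) // (nth_map h) // => /ip.
Qed.

Hypothesis symH : symmetric H.

Lemma tedge_path_H (s : seq V) h N y p : path H h s -> size s = N ->
  path (tedge (nth h (h :: s)) N) y p -> path H y p.
Proof.
move=> ps ss; apply: sub_path => a b /tedgeP[i iN].
have Hi : H (nth h (h :: s) i) (nth h (h :: s) i.+1).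
  by move/(pathP h): ps => /(_ i) /=; apply; rewrite ss.
by case=> -[-> ->] //; rewrite symH.
Qed.

Lemma extremal_path_surgery K K1 r n h s : (0 < K)%N -> (0 < K1)%N -> (K <= r)%N ->
  (4 * K1 <= r)%N -> (r <= n)%N -> path H h s -> size s = (9 * (K * r) + n)%N ->
  excess 4 K (h :: s) = 0%N -> excess (1000 * K) K1 (h :: s) = 0%N ->
  exists a z, [/\ (a < 9 * (K * r))%N, path H (nth h (h :: s) a) z, size z = r &
    extremal_path (rev z ++ take (n - r).+1 (drop a (h :: s)))].
Proof.
move=> K0 K10 Kr K1r rn ps ss e4 e1.
have lp L K' m : excess L K' (h :: s) = 0%N -> (m <= 9 * (K * r) + n)%N ->
    (L * \sum_(i < m) loops (nth h (h :: s)) (9 * (K * r) + n) K' i <= m)%N.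
  move=> e mN; have := @excess_bound _ L K' (h :: s) m; rewrite e addn0 /= ss.
  rewrite (leqW mN) => /(_ isT); congr (_ * _ <= _)%N; apply: eq_bigr => i _.
  rewrite (loops_loopsum _ _ (s := h :: s)) //= ?ss //.
  by apply: ltnW; apply: leq_trans mN.
have [a [z [aA sz pz ext]]] := surgery (x := nth h (h :: s)) K0 K10
  (fun m => @lp _ _ m e4) (fun m => @lp _ _ m e1) Kr K1r rn erefl.
exists a, z; split => //; first exact: tedge_path_H pz.
set q := rev z ++ _.
have sq : size q = n.+1.
  by rewrite size_cat size_rev size_takel ?sz ?size_drop /= ?ss; lia.
rewrite /extremal_path; case eq: q sq => [|h' t] //= [st].
apply/asboolP; rewrite st; apply: extremal_pattern ext => i j iN jN.
(* The default values of the two nth differ, but are not reached up to time n. *)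
suff E k : (k <= n)%N -> nth h' (h' :: t) k = surgered (nth h (h :: s)) a r n z k.
  by rewrite !E.
move=> kn; rewrite -eq /surgered /q nth_cat size_rev sz; case: ltnP => kr.
  rewrite nth_rev sz // (set_nth_default (nth h (h :: s) a)) ?sz; last lia.
  by congr (nth _ _ _); lia.
rewrite nth_take; last lia.
by rewrite nth_drop (set_nth_default h) //= ss; lia.
Qed.

End Target.

Lemma bounded_sum_tail (R : realType) (u : nat -> R) (C e : R) :
  (forall l, 0 <= u l) -> (forall N, \sum_(l < N) u l <= C) -> 0 < e ->
  exists2 K, (0 < K)%N & forall N, \sum_(l < N) (K <= l)%N%:R * u l <= e.
Proof.
move=> u0 uC e0; pose S := range (fun N => \sum_(l < N) u l).
have supS : has_sup S.
  split; first by exists (\sum_(l < 0) u l), 0%N.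
  by exists C => _ [N _ <-].
have [_ [k _ <-] ke] := sup_adherent e0 supS.
exists k.+1 => // N.
have [Nk|kN] := leqP N k.+1.
  rewrite big1 ?ltW // => l _.
  by rewrite leqNgt (leq_trans (ltn_ord l) Nk) mul0r.
have SN : \sum_(l < N) u l <= sup S by apply: ub_le_sup; [case: supS|exists N].
have : \sum_(l < k) u l + \sum_(l < N) (k.+1 <= l)%N%:R * u l <= \sum_(l < N) u l.
  rewrite (big_ord_widen _ _ (_ : k <= N)%N) ?big_mkcond -?big_split /=; last lia.
  apply: ler_sum => l _; have [lk|lk|lk] := ltngtP l k.
  - by rewrite mul0r addr0.
  - by rewrite mul1r add0r.
  - by rewrite mul0r addr0.
lra.
Qed.

Section Core.
Variables (R : realType) (V : choiceType) (H : rel V) (D : nat).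
Hypotheses (lfH : locally_finite H) (D_gt0 : (0 < D)%N).
Hypotheses (degH : forall x, degree H x = D) (trH : vertex_transitive H).
Hypothesis symH : symmetric H.
Local Notation mean := (@path_mean R V H D).

Lemma last_belast_rev (y : V) (w : seq V) : path H y w ->
  exists q, [/\ path H (last y w) q, last (last y w) q = y, size q = size w &
     belast (last y w) q = rev w].
Proof.
move=> pw; exists (rev (belast y w)).
have e : last y w :: rev (belast y w) = rcons (rev w) y.
  by rewrite -rev_rcons -lastI rev_cons.
have := e; rewrite [in LHS]lastI => /rcons_inj[eb el].
by split; rewrite ?size_rev ?size_belast // rev_path -(eq_path (e := H)).
Qed.

(** Averaging over the reversed pendant path and over the path that follows it
    amounts to averaging over paths that start at the end of the pendant path,
    up to the cost of prescribing [r] steps; the starting point is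
    irrelevant by shape invariance. *)
Lemma path_mean_surgery_le r n (v x : V) : (r <= n)%N ->
  mean (n - r) x (fun s => D%:R ^+ r *
     mean r x (fun z => (extremal_path (rev (behead z) ++ s))%:R)) <=
  D%:R ^+ r * D%:R ^+ r * mean n v (fun s => (extremal_path s)%:R).
Proof.
move=> rn; rewrite path_meanZ path_mean_exchange -mulrA ler_wpM2l ?exprn_ge0 //.
rewrite -[leRHS](path_mean_cst D_gt0 degH r x); apply: (path_mean_le _ lfH) => w pw sw /=.
have [q [pq lq sq <-]] := last_belast_rev pw.
have := @path_mean_prefix_path R V H D lfH (n - r) (last x w) q
  (fun s => (extremal_path s)%:R) (fun=> ler0n _ _) pq D_gt0.
rewrite lq sq sw subnKC // => h; apply: le_trans h _.
rewrite (path_mean_shape D lfH trH _ _ v) // => phi s ip.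
by rewrite extremal_path_shape.
Qed.

(** With probability at least 1/2 both excesses vanish, and then one of the [A]
    suffixes of the path admits a surgery; each suffix contributes
    at most [D ^ r * D ^ r] times the probability of being extremal. *)
Lemma extremal_path_prob_lower (o : V) (C : R) :
  (forall N, \sum_(l < N) l%:R * return_prob R H D o l <= C) ->
  exists2 c : R, 0 < c &
    exists n0, forall n, (n0 <= n)%N -> c <= mean n o (fun s => (extremal_path s)%:R).
Proof.
move=> hC; pose u l := l%:R * return_prob R H D o l.
have u0 l : 0 <= u l by rewrite mulr_ge0 // return_prob_ge0.
have tail (e : R) : 0 < e -> exists2 K, (0 < K)%N & forall N,
    \sum_(l < N) (l * (K <= l))%:R * return_prob R H D o l <= e.
  move=> e0; have [K K0 KN] := bounded_sum_tail u0 hC e0; exists K => // N.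
  have := KN N; congr (_ <= _); apply: eq_bigr => l _.
  by rewrite /u natrM mulrCA mulrA.
(* Levels 4 * 16^-1 and 1000 K / (4 * 1000 K): each excess is positive with
   probability at most 1/4. *)
have [K K0 KN] := tail (16^-1) ltac:(by rewrite invr_gt0).
have L0 : (0 < (1000 * K)%:R :> R) by rewrite ltr0n muln_gt0.
have [K1 K10 KN1] := tail ((4 * (1000 * K)%:R)^-1)
  ltac:(by rewrite invr_gt0 mulr_gt0).
pose r := (K + 4 * K1)%N; pose A := (9 * (K * r))%N.
have A0 : 0 < A%:R :> R by rewrite ltr0n /A /r; lia.
have Dr0 : 0 < D%:R ^+ r :> R by rewrite exprn_gt0 // ltr0n.
exists (2^-1 / (A%:R * (D%:R ^+ r * D%:R ^+ r))).
  by rewrite divr_gt0 ?invr_gt0 // !mulr_gt0.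
exists r => n rn; rewrite ler_pdivrMr ?mulr_gt0 //.
pose good (s : seq V) := (excess 4 K s == 0)%N && (excess (1000 * K) K1 s == 0)%N.
have good_half : 2^-1 <= mean (A + n) o (fun s => (good s)%:R).
  have e1 := @excess_prob R V H D lfH D_gt0 degH trH o 4 K (A + n) o.
  have e2 := @excess_prob R V H D lfH D_gt0 degH trH o (1000 * K) K1 (A + n) o.
  have e1' := le_trans e1 (ler_wpM2l (ler0n _ 4) (KN _)).
  have e2' := le_trans e2 (ler_wpM2l (ler0n _ (1000 * K)) (KN1 _)).
  have : 1 <= mean (A + n) o (fun s => (good s)%:R) +
     (mean (A + n) o (fun s => (0 < excess 4 K s)%N%:R) +
      mean (A + n) o (fun s => (0 < excess (1000 * K) K1 s)%N%:R)).
    rewrite -!path_meanD -[leLHS](path_mean_cst D_gt0 degH (A + n) o).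
    apply: (path_mean_le _ lfH) => w _ _.
    rewrite -!natrD ler1n /good.
    by case: (excess 4 K _) => [|?]; case: (excess (1000 * K) K1 _) => [|?].
  move: e2'; rewrite invfM mulrCA divff ?gt_eqF // => e2'.
  lra.
(* Number of pendant paths of length r that make t extremal. *)
pose Phi (t : seq V) : R := D%:R ^+ r * mean r (head o t)
   (fun z => (extremal_path (rev (behead z) ++ take (n - r).+1 t))%:R).
have goodPhi : mean (A + n) o (fun s => (good s)%:R) <=
    \sum_(a < A) mean (A + n) o (fun s => Phi (drop a s)).
  rewrite -path_mean_sum; apply: (path_mean_le _ lfH) => w pw sw.
  case: (boolP (good _)) => [/andP[/eqP g1 /eqP g2]|_]; last first.
    by apply: sumr_ge0 => a _; rewrite mulr_ge0 ?exprn_ge0 // path_mean_ge0.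
  have Kr : (K <= r)%N by rewrite /r; lia.
  have K1r : (4 * K1 <= r)%N by rewrite /r; lia.
  have [a [z [aA pz sz tz]]] := extremal_path_surgery symH K0 K10 Kr K1r rn pw sw g1 g2.
  rewrite (bigD1 (Ordinal aA)) //= -[leLHS]addr0; apply: lerD; last first.
    by apply: sumr_ge0 => b _; rewrite mulr_ge0 ?exprn_ge0 // path_mean_ge0.
  rewrite /Phi /path_mean mulrA -exprMn divff ?pnatr_eq0 -?lt0n // expr1n mul1r.
  have eh : head o (drop a (o :: w)) = nth o (o :: w) a.
    by rewrite -nth0 nth_drop addn0.
  rewrite eh (big_rem (nth o (o :: w) a :: z)) /=; last first.
    by apply/(mem_paths lfH); exists z.
  by rewrite tz lerDl sumr_ge0.
apply: le_trans good_half _; apply: le_trans goodPhi _.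
pose B := D%:R ^+ r * D%:R ^+ r * mean n o (fun s => (extremal_path s)%:R).
have -> : mean n o (fun s => (extremal_path s)%:R) * (A%:R * (D%:R ^+ r * D%:R ^+ r)) =
    \sum_(a < A) B.
  by rewrite sumr_const card_ord -[B *+ _]mulr_natl /B [LHS]mulrC -!mulrA.
apply: ler_sum => a _.
have aA : (a < A)%N := ltn_ord a.
have aAn : (a <= A + n)%N by lia.
rewrite -{1}(subnKC aAn) path_mean_markov //.
rewrite -[leRHS](path_mean_cst D_gt0 degH a o); apply: (path_mean_le _ lfH) => w _ sw.
set x := last o (o :: w).
have -> : mean (A + n - a) x (fun t => Phi (drop a ((o :: w) ++ behead t))) =
    mean ((n - r) + (A + r - a)) x Phi.
  rewrite (_ : (A + n - a = (n - r) + (A + r - a))%N); last lia.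
  apply: (path_mean_eq _ lfH) => t _ _ /=; congr Phi.
  by rewrite -cat_cons (lastI o w) cat_rcons drop_size_cat ?size_belast // -sw.
rewrite (path_mean_prefix lfH D_gt0 degH) => [|s t ss]; last first.
  by rewrite /Phi take_size_cat // take_oversize ?ss //; case: s ss.
apply: le_trans (path_mean_surgery_le o x rn); rewrite le_eqVlt; apply/orP; left; apply/eqP.
apply: (path_mean_eq _ lfH) => t _ st; rewrite /Phi take_oversize //= st //.
Qed.

End Core.

(** * From the random walk to averages over paths *)
Lemma sum_measure_le d (T : measurableType d) (R : realType)
    (mu : {measure set T -> \bar R}) (I : eqType) (r : seq I) (F : I -> set T) (E : set T) :
  uniq r -> measurable E -> (forall i, i \in r -> measurable (F i)) ->
  (forall i, i \in r -> F i `<=` E) ->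
  (forall i j, i \in r -> j \in r -> i != j -> F i `&` F j = set0) ->
  (\sum_(i <- r) mu (F i) <= mu E)%E.
Proof.
elim: r E => [|i r IH] E; first by rewrite big_nil.
move=> /= /andP[ir ur] mE mF FE dF; rewrite big_cons.
have mi : measurable (F i) by apply: mF; rewrite mem_head.
have -> : mu E = (mu (F i) + mu (E `\` F i))%E.
  rewrite -measureU //; first by rewrite setDUK //; apply: FE; rewrite mem_head.
  - exact: measurableD.
  - by rewrite setDE setICA setICr setI0.
apply: leeD2l; apply: IH => //.
- exact: measurableD.
- by move=> j jr; apply: mF; rewrite inE jr orbT.
- move=> j jr w Fj; split; first by apply: FE Fj; rewrite inE jr orbT.
  move=> Fi; have : (F i `&` F j) w by [].
  rewrite dF ?mem_head ?inE ?jr ?orbT //.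
  by apply: contraNneq ir => ->.
- by move=> j k jr kr; apply: dF; rewrite inE ?jr ?kr orbT.
Qed.

Section Bridge.
Variables (R : realType) (V : choiceType) (H : rel V) (D : nat).
Hypotheses (lfH : locally_finite H) (D_gt0 : (0 < D)%N).
Hypotheses (degH : forall x, degree H x = D).
Variables (d : measure_display) (Omega : measurableType d) (P : probability Omega R).
Variables (X : nat -> Omega -> V) (v : V).
Hypothesis srw : is_simple_random_walk P X H v.
Local Notation mean := (@path_mean R V H D).

Let cyl (s : seq V) : set Omega := cylinder X (nth v s) (size s).-1.

Lemma measurable_cylinder x n : measurable (cylinder X x n).
Proof.
case: srw => mX _ _ _; elim: n => [|n IH].
  rewrite (_ : cylinder X x 0 = [set w | X 0 w = x 0%N]); first exact: mX.
  apply/seteqP; split => w /=; first exact.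
  by move=> h i; rewrite leqn0 => /eqP ->.
rewrite (_ : cylinder X x n.+1 = cylinder X x n `&` [set w | X n.+1 w = x n.+1]).
  exact: measurableI.
apply/seteqP; split => w /=.
  by move=> h; split; [move=> i ni; apply: h; apply: leqW|apply: h].
by move=> [h1 h2] i; rewrite leq_eqVlt => /orP[/eqP ->|] //; exact: h1.
Qed.

Lemma cylinder_prob x n : x 0%N = v -> (forall i, (i < n)%N -> H (x i) (x i.+1)) ->
  P (cylinder X x n) = (D%:R^-1 ^+ n)%:E.
Proof.
move=> x0; case: srw => _ P0 Pn _; elim: n => [|n IH] hx.
  rewrite (_ : cylinder X x 0 = [set w | X 0 w = v]) // -x0.
  apply/seteqP; split => w /=; first exact.
  by move=> h i; rewrite leqn0 => /eqP ->.
rewrite Pn IH; last by move=> i ni; apply: hx; apply: leqW.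
by rewrite /step_prob hx // degH -EFinM exprSr.
Qed.

Lemma cyl_prob n s : s \in paths H n v -> P (cyl s) = (D%:R^-1 ^+ n)%:E.
Proof.
case/(mem_paths lfH) => w [-> pw sw]; rewrite /cyl /= sw.
apply: cylinder_prob => // i iN; move/(pathP v): pw => /(_ i).
by rewrite sw; apply.
Qed.

Lemma cyl_disjoint n s t : s \in paths H n v -> t \in paths H n v -> s != t ->
  cyl s `&` cyl t = set0.
Proof.
move=> /(mem_paths lfH)[w [-> _ sw]] /(mem_paths lfH)[u [-> _ su]] st.
apply/seteqP; split => // o /= []; rewrite /cyl /= sw su => h1 h2.
case/eqP: st; apply: (@eq_from_nth _ v); rewrite /= sw ?su // => i iN.
by rewrite -h1 -?h2 // -ltnS.
Qed.

(** The cylinders of the [n]-step paths are disjoint and have mass [D ^ (- n)];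
    the set [A] leaves room for the randomness of the estimator. *)
Lemma path_mean_cyl_le n (f : pred (seq V)) (c : R) (E : set Omega) (A : set Omega) :
  measurable E -> measurable A ->
  (forall s, s \in paths H n v -> f s -> cyl s `&` A `<=` E) ->
  (forall s, s \in paths H n v -> f s ->
     ((c * D%:R^-1 ^+ n)%:E <= P (cyl s `&` A))%E) ->
  ((c * mean n v (fun s => (f s)%:R))%:E <= P E)%E.
Proof.
move=> mE mA cE cA.
have mem s : s \in [seq s <- paths H n v | f s] -> f s /\ s \in paths H n v.
  by rewrite mem_filter => /andP[].
apply: (@le_trans _ _ (\sum_(s <- [seq s <- paths H n v | f s]) P (cyl s `&` A))%E).
  rewrite /path_mean mulrA mulr_sumr -sumEFin big_filter [leRHS]big_mkcond /=.
  rewrite big_seq [leRHS]big_seq; apply: lee_sum => s ms.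
  by case: ifPn => fs; rewrite ?mulr0 ?mulr1 //; apply: cA.
apply: sum_measure_le => //.
- exact/filter_uniq/paths_uniq.
- by move=> s _; apply: measurableI => //; apply: measurable_cylinder.
- by move=> s /mem[fs ms]; apply: cE.
- move=> s t /mem[_ ms] /mem[_ mt] st.
  by rewrite setIACA (cyl_disjoint ms mt st) set0I.
Qed.

Lemma Psi_prob_lower (Y : nat -> Omega -> V) n : is_Psi_of_trace P X Y ->
  ((2^-1 * mean n v (fun s => (extremal_path s)%:R))%:E <= P [set w | Y n w = v])%E.
Proof.
move=> [mY YP]; apply: (path_mean_cyl_le (A := [set w | Y n w = v])) => [||s _ _ w []|] //.
move=> s ms ts; have := cyl_prob ms.
  case/(mem_paths lfH): ms ts => w [-> pw sw] /= /asboolP; rewrite sw => ext.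
  rewrite /cyl /= sw YP // => ->; rewrite -EFinM lee_fin mulrC.
  by rewrite ler_wpM2l ?Dexp_ge0 // (extremal_Psi ext).
Qed.

End Bridge.

(** * Renewal: from first returns to all returns *)
Section Renewal.
Variables (R : realFieldType).

Lemma sum_convolution_le (a b : nat -> R) N :
  (forall m, 0 <= a m) -> (forall k, 0 <= b k) ->
  \sum_(l < N) \sum_(m < l.+1) a m * b (l - m)%N <=
  (\sum_(m < N) a m) * \sum_(k < N) b k.
Proof.
move=> a0 b0.
rewrite (eq_bigr (fun l : 'I_N => \sum_(m < N | (m < l.+1)%N) a m * b (l - m)%N)); last first.
  by move=> l _; rewrite (big_ord_widen _ (fun m => a m * b (l - m)%N) (ltn_ord l)).
rewrite (exchange_big_dep xpredT) //= mulr_suml; apply: ler_sum => m _.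
rewrite -mulr_sumr ler_wpM2l //.
rewrite -(big_mkord (fun l => (m < l.+1)%N) (fun l => b (l - m)%N)).
rewrite (big_cat_nat (n := m)) //=; last exact: ltnW.
rewrite big_nat_cond big_pred0 ?add0r; last first.
  by move=> l; apply/negP => /andP[/andP[_ lm]]; rewrite ltnS leqNgt lm.
rewrite big_mkcond /= (big_addn 0 N m) big_mkord.
rewrite (big_ord_widen N (fun k => if (m < (k + m).+1)%N then b (k + m - m)%N else 0)) ?leq_subr //.
rewrite big_mkcond; apply: ler_sum => k _; case: ifP => // _.
by rewrite addnK; case: ifP.
Qed.

(** With [A] and [B] the partial sums of [l * p l] and [p l], splitting
    [l = m + (l - m)] in the renewal inequality gives [B <= 1 + F * B] and
    [A <= G * B + F * A]. *)
Lemma renewal_bound (p f : nat -> R) (F G : R) :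
  (forall l, 0 <= p l) -> (forall l, 0 <= f l) ->
  (forall l, p l <= (l == 0%N)%:R + \sum_(m < l.+1) f m * p (l - m)%N) ->
  F < 1 -> (forall N, \sum_(m < N) f m <= F) ->
  (forall N, \sum_(m < N) m%:R * f m <= G) ->
  forall N, \sum_(l < N) l%:R * p l <= G / (1 - F) ^+ 2.
Proof.
move=> p0 f0 pf F1 fF fG N.
pose B := \sum_(l < N) p l; pose A := \sum_(l < N) l%:R * p l.
have B0 : 0 <= B by apply: sumr_ge0.
have A0 : 0 <= A by apply: sumr_ge0 => l _; rewrite mulr_ge0.
have G0 : 0 <= G by apply: le_trans (fG 0%N); rewrite big_ord0.
have F1' : 0 < 1 - F by rewrite subr_gt0.
have BF : B <= 1 + F * B.
  apply: le_trans
    (_ : \sum_(l < N) ((l == 0%N :> nat)%:R + \sum_(m < l.+1) f m * p (l - m)%N) <= _).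
    by apply: ler_sum => l _; exact: pf.
  rewrite big_split /=; apply: lerD.
    case: (N) => [|M]; first by rewrite big_ord0.
    by rewrite big_ord_recl /= big1 ?addr0.
  apply: le_trans (sum_convolution_le N f0 p0) _.
  by rewrite ler_wpM2r.
have AG : A <= G * B + F * A.
  pose f1 m := m%:R * f m; pose p1 l := l%:R * p l.
  have f10 m : 0 <= f1 m by rewrite mulr_ge0.
  have p10 m : 0 <= p1 m by rewrite mulr_ge0.
  apply: (@le_trans _ _ (\sum_(l < N) (\sum_(m < l.+1) f1 m * p (l - m)%N +
                                      \sum_(m < l.+1) f m * p1 (l - m)%N))).
    apply: ler_sum => l _; apply: le_trans (ler_wpM2l (ler0n _ l) (pf l)) _.
    rewrite mulrDr [X in X + _](_ : _ = 0); last by case: (l : nat) => [|k]; rewrite ?mul0r ?mulr0.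
    rewrite add0r mulr_sumr -big_split /=; apply: ler_sum => m _.
    rewrite /f1 /p1 natrB; last by rewrite -ltnS.
    by rewrite le_eqVlt; apply/orP; left; apply/eqP; ring.
  rewrite big_split /=; apply: lerD.
    by apply: le_trans (sum_convolution_le N f10 p0) _; rewrite ler_wpM2r.
  by apply: le_trans (sum_convolution_le N f0 p10) _; rewrite ler_wpM2r.
have Bb : B <= (1 - F)^-1 by rewrite -[leRHS]mul1r ler_pdivlMr //; lra.
rewrite -/A ler_pdivlMr ?exprn_gt0 // expr2 mulrA.
have h1 : A * (1 - F) <= G * B by lra.
apply: le_trans (ler_wpM2r (ltW F1') h1) _.
rewrite -mulrA -[leRHS]mulr1 ler_wpM2l //.
by rewrite -ler_pdivlMr // mul1r.
Qed.

End Renewal.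

Section FirstReturn.
Variable V : choiceType.
Local Open Scope nat_scope.

Definition first_returns_at (l : nat) (s : seq V) : bool :=
  [&& 0 < l, returns_at l s & all (fun i => ~~ returns_at i s) (iota 1 l.-1)].

Lemma first_returns_at_cat l s t : l < size s -> first_returns_at l (s ++ t) = first_returns_at l s.
Proof.
move=> ls; rewrite /first_returns_at returns_at_cat //; congr [&& _, _ & _].
by apply: eq_in_all => i; rewrite mem_iota => i1; rewrite returns_at_cat //; lia.
Qed.

Lemma returns_at_first l s : 0 < l -> returns_at l s ->
  exists2 m, m < l.+1 & first_returns_at m s && returns_at l s.
Proof.
move=> l0 rl; have ex : exists m, (0 < m) && returns_at m s by exists l; rewrite l0.
case: (ex_minnP ex) => m /andP[m0 rm] mmin; exists m.
  by rewrite ltnS; apply: mmin; rewrite l0.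
rewrite /first_returns_at m0 rm rl andbT /=; apply/allP => i; rewrite mem_iota => i1.
by apply/negP => ri; have := mmin i; rewrite ri andbT; lia.
Qed.

End FirstReturn.

Section ReturnDecomposition.
Variables (R : realType) (V : choiceType) (H : rel V) (D : nat).
Hypotheses (lfH : locally_finite H) (D_gt0 : (0 < D)%N).
Hypotheses (degH : forall x, degree H x = D).
Variable v : V.
Local Notation mean := (@path_mean R V H D).
Local Notation p := (return_prob R H D v).

Definition first_return_prob (l : nat) : R := mean l v (fun s => (first_returns_at l s)%:R).

(** Markov property at the first return. *)
Lemma return_prob_renewal l :
  p l <= (l == 0%N)%:R + \sum_(m < l.+1) first_return_prob m * p (l - m)%N.
Proof.
have [->|l0] := posnP l.
  rewrite /return_prob path_mean0 /= eqxx lerDl sumr_ge0 // => m _.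
  by rewrite mulr_ge0 // ?return_prob_ge0 // path_mean_ge0.
rewrite add0r {1}/return_prob.
apply: (@le_trans _ _ (\sum_(m < l.+1)
  mean l v (fun s => (first_returns_at m s && returns_at l s)%:R))).
  rewrite -path_mean_sum; apply: (path_mean_le _ lfH) => w _ _.
  case: (boolP (returns_at l (v :: w))) => rl; last by apply: sumr_ge0.
  have [m ml fm] := returns_at_first l0 rl.
  rewrite rl andbT in fm; rewrite (bigD1 (Ordinal ml)) //= fm lerDl.
  by apply: sumr_ge0.
apply: ler_sum => m _; have ml : (m <= l)%N by rewrite -ltnS.
rewrite -{1}(subnKC ml) (path_mean_markov _ lfH) /first_return_prob mulrC -path_meanZ.
apply: (path_mean_le _ lfH) => w _ sw; have ms : (m < size (v :: w))%N by rewrite /= sw.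
case: (boolP (first_returns_at m (v :: w))) => fm; last first.
  rewrite mulr0 -[leRHS](path_mean_cst D_gt0 degH (l - m) (last v (v :: w))).
  by apply: (path_mean_le _ lfH) => t _ _; rewrite first_returns_at_cat // (negbTE fm).
have lw : last v (v :: w) = v.
  case/and3P: fm => _ /andP[_ /eqP e] _; rewrite -[RHS]e.
  by rewrite [LHS]/= (last_nth v) sw.
rewrite mulr1 lw; apply: (path_mean_le _ lfH) => t _ st.
rewrite ler_nat first_returns_at_cat // fm /=.
have e : v :: w ++ t = belast v w ++ v :: t.
  by rewrite -cat_cons (lastI v w) cat_rcons; move: lw => /= ->.
have nl : nth v (v :: w ++ t) l = nth v (v :: t) (l - m).
  by rewrite e nth_cat size_belast sw ltnNge ml.
by rewrite nl st ltnSn /=; case: (_ == v); rewrite ?andbF ?andbT ?leq_b1.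
Qed.

End ReturnDecomposition.

(** * Strong transience bounds the moments of the return probabilities *)
Section StrongTransience.
Variables (R : realType) (V : choiceType) (H : rel V) (D : nat).
Hypotheses (lfH : locally_finite H) (D_gt0 : (0 < D)%N).
Hypotheses (degH : forall x, degree H x = D).
Variables (d : measure_display) (Omega : measurableType d) (P : probability Omega R).
Variables (X : nat -> Omega -> V) (v : V).
Hypothesis srw : is_simple_random_walk P X H v.
Local Notation f := (first_return_prob R H D v).

Let mX n y : measurable [set w | X n w = y].
Proof. by case: srw. Qed.

Definition first_return_event (l : nat) : set Omega :=
  [set w | X l w = v] `&` \bigcap_(i in [set i | (0 < i < l)%N]) ~` [set w | X i w = v].

Lemma measurable_first_return_event l : measurable (first_return_event l).
Proof.
apply: measurableI => //; apply: bigcap_measurableType => i _.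
exact: measurableC.
Qed.

Lemma first_return_prob_le l : (0 < l)%N -> ((f l)%:E <= P (first_return_event l))%E.
Proof.
move=> l0; rewrite -[f l]mul1r; apply: (path_mean_cyl_le lfH srw (A := setT)) => //.
- exact: measurable_first_return_event.
- move=> s /(mem_paths lfH)[w [-> _ sw]] /and3P[_ rl nr] o [+ _]; rewrite /= sw => ho.
  case/andP: rl => _ /eqP rl; split; first by rewrite /= ho.
  move=> i /andP[i0 il] /=; rewrite ho; last exact: ltnW.
  have /allP/(_ i) := nr; rewrite mem_iota add1n prednK // i0 il => /(_ isT).
  rewrite /returns_at /= sw ltnS (ltnW il) /= => /eqP; exact.
- move=> s ms _; rewrite setIT (cyl_prob lfH degH srw ms) mul1r //.
Qed.

Lemma first_return_event_disjoint k l : (0 < k)%N -> (0 < l)%N -> k != l ->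
  first_return_event k `&` first_return_event l = set0.
Proof.
move=> k0 l0 kl; wlog lt : k l k0 l0 kl / (k < l)%N.
  move=> W; have [lt|lt|e] := ltngtP k l; first exact: W.
    by rewrite setIC; apply: W => //; rewrite eq_sym.
  by rewrite e eqxx in kl.
apply/seteqP; split => // w [[wk _] [_ /(_ k)]]; rewrite /= k0 lt; exact.
Qed.

Lemma return_time_first l w : (0 < l)%N -> first_return_event l w ->
  return_time R X v w = l%:R%:E.
Proof.
move=> l0 [wl nw]; apply/eqP; rewrite eq_le; apply/andP; split.
  by apply: ereal_inf_lbound; exists l.
apply: le_ereal_inf_tmp => _ [t /= [t0 wt] <-]; rewrite lee_fin ler_nat leqNgt.
by apply/negP => tl; apply: (nw t) => //=; rewrite t0.
Qed.

Lemma returnsE : returns R X v = \bigcup_(t in [set t | (0 < t)%N]) [set w | X t w = v].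
Proof.
apply/seteqP; split => w.
  move=> rw; apply: contrapT => nr.
  suff e : return_time R X v w = +oo%E by move: rw; rewrite /returns /= e ltxx.
  rewrite /return_time (_ : [set _ | t in _] = set0) ?ereal_inf0 //.
  by apply/seteqP; split => // u [t [t0 wt] _]; apply: nr; exists t.
move=> [t t0 wt]; rewrite /returns /=.
apply: (@le_lt_trans _ _ (t%:R%:E)); last exact: ltry.
by apply: ereal_inf_lbound; exists t.
Qed.

Lemma measurable_returns : measurable (returns R X v).
Proof.
rewrite returnsE; apply: bigcup_measurable => t _; exact: mX.
Qed.

Lemma measurable_return_time E : measurable_fun E (return_time R X v).
Proof.
pose g (t : nat) w : \bar R := if `[< (0 < t)%N /\ X t w = v >] then t%:R%:E else +oo%E.
have -> : return_time R X v = fun w => einfs (g ^~ w) 0.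
  apply/funext => w; apply/eqP; rewrite eq_le; apply/andP; split.
    apply: le_ereal_inf_tmp => _ [t _ <-]; rewrite /g /=; case: asboolP => [tw|_].
      by apply: ereal_inf_lbound; exists t.
    exact: leey.
  apply: le_ereal_inf_tmp => _ [t tw <-]; apply: ereal_inf_lbound; exists t => //.
  by rewrite /g; case: asboolP.
apply: measurable_fun_einfs => t; apply: measurable_funTS.
apply: measurable_fun_ifT => //.
apply: (measurable_fun_bool true).
rewrite setTI (_ : _ @^-1` _ = [set _ | (0 < t)%N] `&` [set w | X t w = v]); last first.
  by apply/seteqP; split => w /= /asboolP.
by case: (0 < t)%N; rewrite ?set_true ?set_false ?setTI ?set0I.
Qed.

Lemma first_return_event_returns l : (0 < l)%N -> first_return_event l `<=` returns R X v.
Proof. by move=> l0 w [wl _]; rewrite returnsE; exists l. Qed.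

Lemma first_return_prob0 : f 0 = 0.
Proof. by rewrite /first_return_prob path_mean0. Qed.

Lemma sum_first_return N : ((\sum_(m < N) f m)%:E <= P (returns R X v))%E.
Proof.
case: N => [|N]; first by rewrite big_ord0.
rewrite big_ord_recl first_return_prob0 add0r -sumEFin.
apply: (@le_trans _ _ (\sum_(m < N) P (first_return_event m.+1))%E).
  by apply: lee_sum => m _; exact: first_return_prob_le.
rewrite -(big_mkord xpredT (fun m => P (first_return_event m.+1))).
apply: sum_measure_le; first exact: iota_uniq.
- exact: measurable_returns.
- by move=> i _; exact: measurable_first_return_event.
- by move=> i _; exact: first_return_event_returns.
- by move=> i j _ _ ij; apply: first_return_event_disjoint.
Qed.

Lemma sum_first_return_time N : ((\sum_(m < N) m%:R * f m)%:E <=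
  \int[P]_(w in returns R X v) return_time R X v w)%E.
Proof.
pose h (l : nat) (w : Omega) : \bar R := (l%:R * \1_(first_return_event l) w)%:E.
have mE l : measurable (first_return_event l) by exact: measurable_first_return_event.
have mr := measurable_returns.
have h0 l w : (0 <= h l w)%E by rewrite lee_fin mulr_ge0.
have mh l E : measurable_fun E (h l).
  by apply/measurable_EFinP; apply: measurable_funM.
apply: (@le_trans _ _ (\int[P]_(w in returns R X v) (\sum_(1 <= l < N) h l w)%E)%E).
  rewrite ge0_integral_sum //.
  case: N => [|N].
    by rewrite big_ord0 big_geq.
  rewrite big_ord_recl mul0r add0r big_add1 /= big_mkord -sumEFin.
  apply: lee_sum => l _.
  rewrite /h (integralZl_indic mr (fun=> first_return_event l.+1)) //; last by rewrite ltNge ler0n.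
  rewrite integral_indic // setIidl; last exact: first_return_event_returns.
  by rewrite EFinM; apply: lee_wpmul2l; [rewrite lee_fin|exact: first_return_prob_le].
apply: ge0_le_integral => //.
- by move=> w _; apply: sume_ge0.
- by apply: emeasurable_sum => l; exact: mh.
- exact: measurable_return_time.
move=> w _.
have [/existsP[/= l /andP[l0 /asboolP wl]]|nl] :=
    boolP [exists l : 'I_N, (0 < l)%N && `[< first_return_event l w >]].
  rewrite (return_time_first l0 wl) (bigD1_seq (l : nat)) /= ?iota_uniq //; last first.
    by rewrite mem_index_iota l0 ltn_ord.
  rewrite big_nat_cond big1 ?adde0.
    by rewrite /h indicE mem_set // mulr1.
  move=> k /andP[/andP[k0 _] kl]; rewrite /h indicE memNset ?mulr0 // => wk.
  have := first_return_event_disjoint k0 l0 kl => /seteqP[/(_ w) + _]; exact.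
rewrite big_nat_cond big1.
  by apply: le_ereal_inf_tmp => _ [t _ <-]; rewrite lee_fin.
move=> k /andP[/andP[k0 kN] _]; rewrite /h indicE memNset ?mulr0 // => wk.
by case/existsP: nl; exists (Ordinal kN); rewrite k0; apply/asboolP.
Qed.

(** If the walk never returns then the conditional expectation degenerates to
    [0 * 0], but then the first return probabilities vanish. *)
Lemma strongly_transient_moment : strongly_transient P X v ->
  exists C, forall N, \sum_(l < N) l%:R * return_prob R H D v l <= C.
Proof.
move=> [tr]; set I := integral _ _ _ => If.
pose F := fine (P (returns R X v)).
have PF : P (returns R X v) = F%:E.
  by rewrite /F fineK // ge0_fin_numE //; apply: (lt_trans tr); exact: ltry.
have F1 : F < 1 by move: tr; rewrite /transient PF lte_fin.
have fF N : \sum_(m < N) first_return_prob R H D v m <= F.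
  by have := sum_first_return N; rewrite PF lee_fin.
have f0 m : 0 <= first_return_prob R H D v m by apply: path_mean_ge0.
have F0 : 0 <= F by apply: le_trans (fF 0%N); rewrite big_ord0.
have [G fG] : exists G, forall N, \sum_(m < N) m%:R * first_return_prob R H D v m <= G.
  have [F_eq0|F_neq0] := eqVneq F 0.
    exists 0 => N; rewrite big1 // => m _.
    have := fF m.+1; rewrite F_eq0 big_ord_recr /= => h.
    have : 0 <= \sum_(i < m) first_return_prob R H D v i by apply: sumr_ge0.
    by move=> h2; rewrite (_ : first_return_prob R H D v m = 0) ?mulr0 //; have := f0 m; lra.
  have I0 : (0 <= I)%E.
    by apply: le_trans (sum_first_return_time 0); rewrite big_ord0.
  have Ioo : (I < +oo)%E.
    rewrite ltey; apply/eqP => Ie; move: If; rewrite Ie -/F gt0_mulye ?ltxx //.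
    by rewrite lte_fin invr_gt0 lt0r F_neq0.
  exists (fine I) => N; rewrite -lee_fin fineK; first exact: sum_first_return_time.
  by rewrite ge0_fin_numE.
exists (G / (1 - F) ^+ 2); apply: (renewal_bound (f := first_return_prob R H D v)) => //.
  by move=> l; apply: return_prob_ge0.
exact: return_prob_renewal.
Qed.

End StrongTransience.

(** Without edges the walk could not make its first step. *)
Lemma walk_degree_gt0 (R : realType) (V : choiceType) (H : rel V) (v : V)
    (d : measure_display) (Omega : measurableType d) (P : probability Omega R)
    (X : nat -> Omega -> V) (D : nat) :
  locally_finite H -> (forall x, degree H x = D) ->
  is_simple_random_walk P X H v -> (0 < D)%N.
Proof.
move=> lfH degH [_ _ _ [A [mA PA HA]]]; rewrite lt0n; apply/eqP => D0.
have : P setT = 0.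
  apply/eqP; rewrite eq_le measure_ge0 andbT -PA; apply: le_measure; rewrite ?inE //.
  move=> w _; apply: HA => /= /(_ 0%N) h.
  have := size_nbrs degH (X 0 w); rewrite D0 => /size0nil e.
  by move: h; rewrite -(mem_nbrs lfH) e.
by rewrite probability_setT => /eqP; rewrite onee_eq0.
Qed.

Lemma vertex_transitive_degree (V : choiceType) (H : rel V) :
  locally_finite H -> vertex_transitive H -> forall x y, degree H x = degree H y.
Proof.
move=> lfH trH x y; have [phi [bphi Hphi <-]] := trH x y.
have := perm_size (perm_nbrs_map lfH x bphi Hphi); rewrite size_map.
by move/esym.
Qed.

Lemma Psi_liminf (R : realType) (V : choiceType) (H : rel V) (v : V)
    (d : measure_display) (Omega : measurableType d) (P : probability Omega R)
    (X Y : nat -> Omega -> V) (D : nat) (C : R) :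
  locally_finite H -> vertex_transitive H -> symmetric H ->
  (forall x, degree H x = D) ->
  is_simple_random_walk P X H v -> is_Psi_of_trace P X Y ->
  (forall N, \sum_(l < N) l%:R * return_prob R H D v l <= C) ->
  (0 < limn_einf (fun n => P [set w | Y n w = v]))%E.
Proof.
move=> lfH trH symH degH srw PsiY hC.
have D0 := walk_degree_gt0 lfH degH srw.
have [c c0 [n0 cn]] := extremal_path_prob_lower lfH D0 degH trH symH hC.
apply: (@lt_le_trans _ _ (2^-1 * c)%:E); first by rewrite lte_fin mulr_gt0 // invr_gt0.
apply: (@le_trans _ _ (einfs (fun n => P [set w | Y n w = v]) n0)).
  apply: le_ereal_inf_tmp => _ [n /= nn <-].
  apply: le_trans (Psi_prob_lower lfH degH srw n PsiY).
  by rewrite lee_fin ler_wpM2l ?invr_ge0 // cn.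
rewrite limn_einf_lim (cvg_lim _ (@cvg_einfs_sup R _)) //.
by apply: ereal_sup_ubound; exists n0.
Qed.

Lemma strongly_transient_Psi_liminf (R : realType) (V : choiceType) (H : rel V) (v : V)
    (d : measure_display) (Omega : measurableType d) (P : probability Omega R)
    (X Y : nat -> Omega -> V) :
  symmetric H -> locally_finite H -> vertex_transitive H ->
  is_simple_random_walk P X H v -> strongly_transient P X v ->
  is_Psi_of_trace P X Y ->
  (0 < limn_einf (fun n => P [set w | Y n w = v]))%E.
Proof.
move=> symH lfH trH srw st PsiY.
have degH x : degree H x = degree H v by apply: vertex_transitive_degree.
have D0 := walk_degree_gt0 lfH degH srw.
have [C hC] := strongly_transient_moment lfH D0 degH srw st.
exact: (Psi_liminf lfH trH symH degH srw PsiY hC).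
Qed.

(** * The one-dimensional walk *)
Section CoinWalk.

(** The number of sequences of [k] signs with sum [z]. *)
Fixpoint coin (k : nat) (z : int) : nat :=
  if k is k'.+1 then (coin k' (z - 1) + coin k' (z + 1))%N else (z == 0).

Lemma coin_out k z : k%:Z < z -> coin k z = 0%N.
Proof.
elim: k z => [|k IH] z zk /=; first by rewrite gt_eqF.
by rewrite !IH //; lia.
Qed.

Lemma coin_bin k i : coin k (k%:Z - (2 * i)%N%:Z) = 'C(k, i).
Proof.
elim: k i => [|k IH] [|i] //=.
  rewrite bin0 (coin_out (z := _ + 1)); last lia.
  by rewrite (_ : _ - 1 = k%:Z - (2 * 0)%N%:Z) ?IH ?bin0 //; lia.
rewrite binS addnC -!IH addnC; congr (coin _ _ + coin _ _)%N; lia.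
Qed.

Lemma coin_odd k i : coin k (k%:Z - (2 * i).+1%N%:Z) = 0%N.
Proof.
elim: k i => [|k IH] [|i] //=.
  rewrite (coin_out (z := _ + 1)); last lia.
  by rewrite (_ : _ - 1 = k%:Z - (2 * 0).+1%N%:Z) ?IH //; lia.
rewrite (_ : _ - 1 = k%:Z - (2 * i.+1).+1%N%:Z) ?IH; last lia.
by rewrite (_ : _ + 1 = k%:Z - (2 * i).+1%N%:Z) ?IH //; lia.
Qed.

(** The central binomial coefficient is at most [4 ^ i / sqrt (2 * i + 1)]: the
    left side divided by [16 ^ i] decreases, because
    [(2 * i + 1) * (2 * i + 3) <= (2 * i + 2) ^ 2]. *)
Lemma central_bin_le i : ((2 * i).+1 * 'C(2 * i, i) ^ 2 <= 16 ^ i)%N.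
Proof.
elim: i => [|i IH] //.
have e : (i.+1 * 'C(2 * i.+1, i.+1) = 2 * (2 * i).+1 * 'C(2 * i, i))%N.
  have e1 : (i.+1 * 'C((2 * i).+2, i.+1) = (2 * i).+2 * 'C((2 * i).+1, i))%N.
    by rewrite -mul_bin_diag.
  have e2 : (i.+1 * 'C((2 * i).+1, i) = (2 * i).+1 * 'C(2 * i, i))%N.
    by have := mul_bin_down (2 * i).+1 i; rewrite (_ : (2 * i).+1 - i = i.+1)%N //; lia.
  rewrite (_ : 2 * i.+1 = (2 * i).+2)%N; last lia.
  rewrite e1 (_ : (2 * i).+2 = 2 * i.+1)%N; last lia.
  by rewrite -mulnA e2 mulnA.
rewrite -(leq_pmul2l (_ : 0 < i.+1 ^ 2)%N) ?expn_gt0 //.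
rewrite mulnCA -expnMn e expnMn.
set c := 'C(2 * i, i) in IH *.
have h : ((2 * i.+1).+1 * (2 * i).+1 <= 4 * i.+1 ^ 2)%N by lia.
apply: (@leq_trans (4 * (4 * i.+1 ^ 2) * ((2 * i).+1 * c ^ 2))%N).
  by move: (leq_mul h (leqnn (4 * ((2 * i).+1 * c ^ 2)))); lia.
rewrite [X in (_ <= X)%N](_ : _ = (4 * (4 * i.+1 ^ 2) * 16 ^ i)%N); last first.
  by rewrite [(16 ^ i.+1)%N]expnS; move: (i.+1 ^ 2)%N (16 ^ i)%N => a b; lia.
by rewrite leq_mul2l IH orbT.
Qed.

Lemma coin0_le k : (k.+1 * coin k 0 ^ 2 <= 4 ^ k)%N.
Proof.
have e := odd_double_half k.
have [ok|ek] := boolP (odd k).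
  by have := coin_odd k k./2; rewrite (_ : _ - _ = 0) => [->|]; [rewrite muln0|lia].
have -> : coin k 0 = 'C(k, k./2).
  by rewrite -coin_bin; congr coin; rewrite (negbTE ek) in e; lia.
move: e; rewrite (negbTE ek) add0n -mul2n; move: (k./2) => i <-.
by rewrite expnM; exact: central_bin_le.
Qed.

End CoinWalk.

(** * A negative moment of the multinomial distribution *)
Section Counts.
Variables (R : realType) (d : nat).
Local Notation counts := {ffun 'I_d -> nat}.
Implicit Types (k : counts) (phi psi : counts -> R).

Definition incr k (i : 'I_d) : counts := [ffun j => (k j + (j == i))%N].

Lemma incrC k i j : incr (incr k i) j = incr (incr k j) i.
Proof. by apply/ffunP => l; rewrite !ffunE addnAC. Qed.

(** Sum of [phi] over the letter counts of the words of length [n] on [d] letters,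
    the letters of [k] being counted in advance. *)
Fixpoint word_sum n phi k : R :=
  if n is m.+1 then \sum_i word_sum m phi (incr k i) else phi k.

Lemma word_sum_last n phi k :
  word_sum n.+1 phi k = word_sum n (fun k' => \sum_i phi (incr k' i)) k.
Proof.
by elim: n k => [|n IH] k //; apply: eq_bigr => i _; exact: IH.
Qed.

Lemma word_sum_incr n phi k i :
  word_sum n phi (incr k i) = word_sum n (fun k' => phi (incr k' i)) k.
Proof.
elim: n k => [|n IH] k //=.
by apply: eq_bigr => j _; rewrite -IH incrC.
Qed.

Lemma word_sum_le n phi psi k : (forall k, phi k <= psi k) ->
  word_sum n phi k <= word_sum n psi k.
Proof.
by move=> h; elim: n k => [|n IH] k //=; apply: ler_sum.
Qed.

Lemma word_sum_ge0 n phi k : (forall k, 0 <= phi k) -> 0 <= word_sum n phi k.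
Proof.
by move=> h; elim: n k => [|n IH] k //=; apply: sumr_ge0 => i _; exact: IH.
Qed.

Lemma word_sum_sum (I : finType) n (phi : I -> counts -> R) k :
  word_sum n (fun k' => \sum_i phi i k') k = \sum_i word_sum n (phi i) k.
Proof.
elim: n k => [|n IH] k //=.
by rewrite exchange_big /=; apply: eq_bigr => j _; rewrite IH.
Qed.

Lemma word_sumD n phi psi k :
  word_sum n (fun k' => phi k' + psi k') k = word_sum n phi k + word_sum n psi k.
Proof.
elim: n k => [|n IH] k //=.
by rewrite -big_split; apply: eq_bigr => j _; rewrite IH.
Qed.

Lemma word_sumZ n c phi k :
  word_sum n (fun k' => c * phi k') k = c * word_sum n phi k.
Proof.
elim: n k => [|n IH] k //=.
by rewrite mulr_sumr; apply: eq_bigr => j _; rewrite IH.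
Qed.

Lemma word_sum1 n k : word_sum n (fun=> 1) k = d%:R ^+ n.
Proof.
elim: n k => [|n IH] k //=.
rewrite (eq_bigr (fun=> d%:R ^+ n)) => [|i _]; last exact: IH.
by rewrite sumr_const card_ord -[_ ^+ n *+ d]mulr_natl -exprS.
Qed.

(** The derivative of the multinomial formula with respect to the weight of the
    letter [m]: marking one occurrence of [m] amounts to choosing its position. *)
Lemma word_sum_derive n m psi k :
  word_sum n (fun k' => (k' m)%:R * psi k') k =
  (k m)%:R * word_sum n psi k + n%:R * word_sum n.-1 psi (incr k m).
Proof.
elim: n k => [|n IH] k /=; first by rewrite mul0r addr0.
rewrite (eq_bigr (fun i => ((k m)%:R * word_sum n psi (incr k i) +
    (m == i)%:R * word_sum n psi (incr k i)) +
    n%:R * word_sum n.-1 psi (incr (incr k m) i))) => [|i _]; last first.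
  by rewrite IH ffunE natrD mulrDl [incr (incr k i) m]incrC.
rewrite !big_split /= -!mulr_sumr -addrA; congr (_ + _).
rewrite (bigD1 m) //= eqxx mul1r big1 => [|i im]; last by rewrite eq_sym (negbTE im) mul0r.
rewrite addr0; case: n {IH} => [|n] /=; first by rewrite mul0r addr0 mul1r.
by rewrite -[in RHS]addn1 natrD mulrDl mul1r addrC.
Qed.

Definition inv_counts (m : nat) k : R :=
  \prod_(j < d) (if (j < m)%N then (k j).+1%:R^-1 else 1).

Lemma inv_counts_ge0 m k : 0 <= inv_counts m k.
Proof. by apply: prodr_ge0 => j _; case: ifP => // _; rewrite invr_ge0. Qed.

(** Inserting the letter [m] at one of the [n + 1] possible positions produces
    each longer word as many times as it contains [m]. *)
Lemma word_sum_inv_counts_step n m (md : (m < d)%N) k0 : k0 (Ordinal md) = 0%N ->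
  n.+1%:R * word_sum n (inv_counts m.+1) k0 <= word_sum n.+1 (inv_counts m) k0.
Proof.
set o := Ordinal md => k00.
pose psi k := (k o)%:R^-1 * inv_counts m k.
have := word_sum_derive n.+1 o psi k0; rewrite k00 mul0r add0r /= => e.
have ei : word_sum n psi (incr k0 o) = word_sum n (inv_counts m.+1) k0.
  rewrite word_sum_incr; apply: (@le_anti _ R); apply/andP.
  suff E k : psi (incr k o) = inv_counts m.+1 k.
    by split; apply: word_sum_le => k; rewrite E.
  rewrite /psi /inv_counts ffunE eqxx addn1 (bigD1 o) //= [in RHS](bigD1 o) //= ltnn ltnSn mul1r.
  congr (_ * _); apply: eq_bigr => j jo; rewrite ffunE (negbTE jo) addn0 ltnS.
  by rewrite [(j <= m)%N]leq_eqVlt; move: jo; rewrite -val_eqE /= => /negbTE ->.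
rewrite -ei -e; apply: ler_sum => i _; apply: word_sum_le => k; rewrite /psi mulrA.
have [->|k1] := eqVneq (k o) 0%N; first by rewrite mul0r mul0r inv_counts_ge0.
by rewrite mulfV ?pnatr_eq0 // mul1r.
Qed.

Lemma word_sum_inv_counts n m : (m <= d)%N ->
  n.+1%:R ^+ m * word_sum n (inv_counts m) [ffun=> 0%N] <= d%:R ^+ (n + m).
Proof.
elim: m n => [|m IH] n md.
  rewrite expr0 mul1r addn0 -(word_sum1 n [ffun=> 0%N]); apply: word_sum_le => k.
  by rewrite /inv_counts big1.
have := @word_sum_inv_counts_step n m md [ffun=> 0%N]; rewrite ffunE => /(_ erefl) h.
rewrite exprSr -mulrA; apply: le_trans (ler_wpM2l _ h) _; first by rewrite exprn_ge0.
rewrite addnS -addSn; apply: le_trans (IH n.+1 (ltnW md)).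
rewrite ler_wpM2r ?lerXn2r ?nnegrE ?ler_nat //.
by apply: word_sum_ge0 => k; exact: inv_counts_ge0.
Qed.

End Counts.

(** * Return probabilities on the lattice *)
Section Lattice.
Variable d : nat.
Local Notation Z := 'rV[int]_d.
Local Notation e i := (delta_mx 0 i : Z).

Lemma deltaE (i j : 'I_d) : (e i) 0 j = (j == i)%:R.
Proof. by rewrite mxE eqxx. Qed.

Lemma delta_sum (i : 'I_d) : \sum_(j < d) `|(e i) 0 j| = 1 :> int.
Proof.
rewrite (bigD1 i) //= deltaE eqxx big1 ?addr0 // => j ji.
by rewrite deltaE (negbTE ji).
Qed.

Lemma lattice_step (x y : Z) :
  lattice x y <-> exists i, y = x + e i \/ y = x - e i.
Proof.
rewrite /lattice; split => [/eqP s1|[i [->|->]]]; last first.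
- by apply/eqP; rewrite -[RHS](delta_sum i); apply: eq_bigr => j _; rewrite !mxE; congr `|_|; ring.
- apply/eqP; rewrite -[RHS](delta_sum i); apply: eq_bigr => j _; rewrite !mxE.
  by rewrite -normrN; congr `|_|; ring.
pose u := y - x.
have us : \sum_(j < d) `|u 0 j| = 1.
  by rewrite -s1; apply: eq_bigr => j _; rewrite !mxE distrC.
have [i ui] : exists i, u 0 i != 0.
  apply/existsP; apply: contra_eqT us => /existsPn u0.
  by rewrite big1 // => j _; have := u0 j; rewrite negbK => /eqP ->.
have rest0 : 0 <= \sum_(j < d | j != i) `|u 0 j| by apply: sumr_ge0.
have ui1 : 1 <= `|u 0 i| by rewrite -gtz0_ge1 normr_gt0.
rewrite (bigD1 i) //= in us.
have [nui r0] : `|u 0 i| = 1 /\ \sum_(j < d | j != i) `|u 0 j| = 0.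
  by move: us rest0 ui1; move: (\sum_(j < d | j != i) `|u 0 j|) `|u 0 i| => a b; lia.
have z j : j != i -> u 0 j = 0.
  move=> ji; apply/eqP; rewrite -normr_eq0; apply/eqP.
  by apply: (psumr_eq0P _ r0) => // k _; exact: normr_ge0.
have [ui_pos|ui_neg] : u 0 i = 1 \/ u 0 i = -1 by lia.
- exists i; left; apply/rowP => j; rewrite mxE deltaE.
  have -> : y 0 j = x 0 j + u 0 j by rewrite !mxE; ring.
  by congr (_ + _); have [->|/z] := eqVneq j i.
- exists i; right; apply/rowP => j; rewrite mxE mxE deltaE.
  have -> : y 0 j = x 0 j + u 0 j by rewrite !mxE; ring.
  by congr (_ + _); have [->|/z] := eqVneq j i.
Qed.

Definition lattice_nbrs (x : Z) : seq Z :=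
  [seq x + e i | i <- enum 'I_d] ++ [seq x - e i | i <- enum 'I_d].

Lemma mem_lattice_nbrs x y : (y \in lattice_nbrs x) = lattice x y.
Proof.
rewrite mem_cat; apply/orP/idP => [H|/lattice_step[i [->|->]]].
- by apply/lattice_step; case: H => /mapP[i _ ->]; exists i; [left|right].
- by left; apply/mapP; exists i => //; rewrite mem_enum.
- by right; apply/mapP; exists i => //; rewrite mem_enum.
Qed.

Lemma delta_inj : injective (fun i => e i).
Proof.
move=> i j /rowP/(_ i); rewrite !deltaE eqxx.
by case: eqVneq.
Qed.

Lemma lattice_nbrs_uniq x : uniq (lattice_nbrs x).
Proof.
have i1 : injective (fun i => x + e i) by move=> i j /= /addrI /delta_inj.
have i2 : injective (fun i => x - e i) by move=> i j /= /addrI /oppr_inj /delta_inj.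
rewrite cat_uniq (map_inj_uniq i1) (map_inj_uniq i2) enum_uniq andbT /=.
apply/hasPn => _ /mapP[i _ ->]; apply/mapP => -[j _ /addrI /rowP/(_ i)].
by rewrite mxE !deltaE eqxx; case: eqVneq.
Qed.

Lemma lattice_locally_finite : locally_finite (@lattice d).
Proof.
move=> x; apply/finite_seqP; exists (lattice_nbrs x).
by apply/seteqP; split => y /=; rewrite mem_lattice_nbrs.
Qed.

Lemma perm_lattice_nbrs x : perm_eq (nbrs (@lattice d) x) (lattice_nbrs x).
Proof.
apply: uniq_perm; [exact: nbrs_uniq|exact: lattice_nbrs_uniq|] => y.
by rewrite mem_nbrs ?mem_lattice_nbrs //; exact: lattice_locally_finite.
Qed.

Lemma lattice_degree x : degree (@lattice d) x = (2 * d)%N.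
Proof.
have := perm_size (perm_lattice_nbrs x).
rewrite size_cat (size_map (fun i => x + e i)) (size_map (fun i => x - e i)).
by rewrite size_enum_ord addnn -mul2n.
Qed.

Lemma lattice_sym : symmetric (@lattice d).
Proof. by move=> x y; rewrite /lattice; congr (_ == _); apply: eq_bigr => i _; rewrite distrC. Qed.

Lemma lattice_transitive : vertex_transitive (@lattice d).
Proof.
move=> x y; exists (fun z => z + (y - x)); split.
- by exists (fun z => z - (y - x)) => z; rewrite ?addrK ?subrK.
- move=> a b; rewrite /lattice; congr (_ == _); apply: eq_bigr => i _.
  by rewrite !mxE; congr `|_|; ring.
- by rewrite addrC subrK.
Qed.

Variable R : realType.
Hypothesis d_gt0 : (0 < d)%N.
Local Notation k0 := ([ffun=> 0%N] : {ffun 'I_d -> nat}).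
Local Notation mean := (@path_mean R Z (@lattice d) (2 * d)).

Definition coin_prob (k : nat) (z : int) : R := (coin k z)%:R / 2 ^+ k.

Lemma coin_probS k z : coin_prob k.+1 z = 2^-1 * (coin_prob k (z - 1) + coin_prob k (z + 1)).
Proof. by rewrite /coin_prob /= natrD exprS invfM; ring. Qed.

Definition coin_prod (x : Z) (k : {ffun 'I_d -> nat}) : R :=
  \prod_(j < d) coin_prob (k j) (x 0 j).

Lemma coin_prod_incr x k i :
  coin_prod x (incr k i) = 2^-1 * coin_prod (x - e i) k + 2^-1 * coin_prod (x + e i) k.
Proof.
rewrite /coin_prod -mulrDr (bigD1 i) //= [X in _ * (X + _)](bigD1 i) //=.
rewrite [X in _ * (_ + X)](bigD1 i) //= ffunE eqxx addn1 coin_probS !mxE !eqxx /=.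
rewrite (eq_bigr (fun j => coin_prob (k j) (x 0 j))); last first.
  by move=> j /negbTE ji; rewrite ffunE ji addn0.
have Em : \prod_(j < d | j != i) coin_prob (k j) ((x - e i) 0 j) =
    \prod_(j < d | j != i) coin_prob (k j) (x 0 j).
  by apply: eq_bigr => j /negbTE ji; rewrite !mxE ji andbF subr0.
have Ep : \prod_(j < d | j != i) coin_prob (k j) ((x + e i) 0 j) =
    \prod_(j < d | j != i) coin_prob (k j) (x 0 j).
  by apply: eq_bigr => j /negbTE ji; rewrite !mxE ji andbF addr0.
by rewrite Em Ep; ring.
Qed.

(** Given how many steps are made along each axis, the coordinates are
    independent one-dimensional walks. *)
Lemma lattice_hit0 n x : mean n x (fun s => (last 0 s == 0)%:R) =
  d%:R^-1 ^+ n * word_sum n (coin_prod x) k0.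
Proof.
elim: n x => [|n IH] x.
  rewrite path_mean0 /= expr0 mul1r /coin_prod.
  have [->|x0] := eqVneq x 0.
    by rewrite big1 // => j _; rewrite ffunE mxE /coin_prob /= expr0 divr1.
  have [j xj] : exists j, x 0 j != 0.
    apply/existsP; apply: contraR x0 => /existsPn x0; apply/eqP/rowP => j.
    by have := x0 j; rewrite negbK mxE => /eqP.
  by rewrite (bigD1 j) //= ffunE /coin_prob /= (negbTE xj) mul0r mul0r.
rewrite word_sum_last path_meanS (perm_big _ (perm_lattice_nbrs x)) big_cat /=.
rewrite (@big_map _ _ _ _ _ (fun i : 'I_d => x + e i)).
rewrite (@big_map _ _ _ _ _ (fun i : 'I_d => x - e i)) !big_enum /=.
have last_cons y : mean n y (fun s => (last 0 (x :: s) == 0)%:R) =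
    mean n y (fun s => (last 0 s == 0)%:R).
  by apply: (path_mean_eq _ lattice_locally_finite) => w _ _.
rewrite word_sum_sum natrM invfM exprSr -big_split /= !mulr_sumr.
apply: eq_bigr => i _; rewrite !last_cons !IH.
have -> : word_sum n (fun k => coin_prod x (incr k i)) k0 =
    2^-1 * (word_sum n (coin_prod (x - e i)) k0 +
            word_sum n (coin_prod (x + e i)) k0).
  rewrite mulrDr -!word_sumZ -word_sumD.
  by congr (word_sum n _ _); apply/funext => k; rewrite coin_prod_incr.
by ring.
Qed.

Lemma lattice_return_prob (v : Z) n : return_prob R (@lattice d) (2 * d) v n =
  d%:R^-1 ^+ n * word_sum n (coin_prod 0) k0.
Proof.
rewrite -lattice_hit0 /return_prob.
rewrite (path_mean_shape _ lattice_locally_finite lattice_transitive n v 0); last first.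
  by move=> phi s ip; rewrite returns_at_shape.
apply: (path_mean_eq _ lattice_locally_finite) => w _ sw.
congr (_%:R); congr nat_of_bool.
by rewrite /returns_at /= sw ltnSn (last_nth 0) sw.
Qed.

Lemma coin_prob0_le k : coin_prob k 0 ^+ 2 <= k.+1%:R^-1.
Proof.
rewrite /coin_prob expr_div_n -exprM -[leRHS]mul1r ler_pdivlMr ?ltr0n //.
rewrite mulrAC ler_pdivrMr ?exprn_gt0 // mul1r mulnC exprM -natrX -natrX -natrX -natrM ler_nat.
by rewrite mulnC; exact: coin0_le.
Qed.

Lemma coin_prod0_sqr_le m k : coin_prod 0 k ^+ 2 <= inv_counts R m k.
Proof.
rewrite /coin_prod /inv_counts -prodrXl; apply: ler_prod => j _.
rewrite mxE exprn_ge0 /=; last by rewrite divr_ge0 ?exprn_ge0.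
apply: le_trans (coin_prob0_le (k j)) _; case: ifP => // _.
by rewrite invf_le1 ?ltr0n // ler1n.
Qed.

(** Cauchy-Schwarz in the linearised form [a <= (c * a ^ 2 + 1 / c) / 2].  Five
    of the [d] coordinates are used, the factors of the others being at most 1. *)
Lemma lattice_return_le (v : Z) n (c : R) : (5 <= d)%N -> 0 < c ->
  return_prob R (@lattice d) (2 * d) v n <=
  2^-1 * (c * (d%:R ^+ 5 / n.+1%:R ^+ 5) + c^-1).
Proof.
move=> d5 c0; rewrite lattice_return_prob.
have dn0 : 0 < d%:R ^+ n :> R by rewrite exprn_gt0 // ltr0n.
rewrite exprVn mulrC ler_pdivrMr //.
have h := word_sum_inv_counts R n d5.
have n5 : 0 < n.+1%:R ^+ 5 :> R by rewrite exprn_gt0.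
have h' : word_sum n (inv_counts R 5) k0 <= d%:R ^+ n * (d%:R ^+ 5 / n.+1%:R ^+ 5).
  by rewrite mulrA -exprD ler_pdivlMr // mulrC.
apply: (@le_trans _ _ (word_sum n (fun k => 2^-1 * (c * inv_counts R 5 k + c^-1 * 1)) k0)).
  apply: word_sum_le => k; have := coin_prod0_sqr_le 5 k.
  set a := coin_prod 0 k; set b := inv_counts R 5 k => ab.
  have h1 : c * a ^+ 2 <= c * b by rewrite ler_wpM2l // ltW.
  have h2 : 0 <= c * (a - c^-1) ^+ 2 by rewrite mulr_ge0 ?sqr_ge0 // ltW.
  have h3 : c * (a - c^-1) ^+ 2 = c * a ^+ 2 - 2 * a + c^-1.
    by field; exact: lt0r_neq0.
  rewrite h3 in h2; lra.
rewrite word_sumZ word_sumD !word_sumZ word_sum1 -mulrA ler_wpM2l ?invr_ge0 //.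
rewrite [leRHS]mulrDl lerD //.
by rewrite -mulrA (ler_wpM2l (ltW c0)) // mulrC.
Qed.

End Lattice.

(** The terms are dominated by the increments of [- 4 / sqrt l]. *)
Lemma sum_inv_three_halves (R : realType) N :
  \sum_(l < N) (l.+1%:R * Num.sqrt l.+1%:R)^-1 <= 4 - 4 / Num.sqrt N.+1%:R :> R.
Proof.
elim: N => [|N IH]; first by rewrite big_ord0 sqrtr1 divr1 subrr.
rewrite big_ord_recr /=; apply: le_trans (lerD IH (lexx _)) _.
set s := Num.sqrt N.+1%:R; set t := Num.sqrt N.+2%:R.
have s0 : 0 < s :> R by rewrite sqrtr_gt0 ltr0n.
have t0 : 0 < t :> R by rewrite sqrtr_gt0 ltr0n.
have s2 : s ^+ 2 = N.+1%:R by rewrite sqr_sqrtr.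
have t2 : t ^+ 2 = s ^+ 2 + 1 by rewrite s2 sqr_sqrtr // -[N.+2]addn1 natrD.
have s1 : 1 <= s ^+ 2 by rewrite s2 ler1n.
rewrite -s2.
have e1 : 4 / s - 4 / t - (s ^+ 2 * s)^-1 =
   (4 * s ^+ 2 * (t - s) - t) / (s ^+ 3 * t).
  by field; rewrite !(lt0r_neq0 s0, lt0r_neq0 t0).
have e2 : (4 * s ^+ 2 * (t - s) - t) * (t + s) = 4 * s ^+ 2 * (t ^+ 2 - s ^+ 2) - t ^+ 2 - t * s.
  by ring.
have ts : t <= 2 * s.
  by rewrite -(ler_pXn2r (n := 2)) ?nnegrE ?mulr_ge0 ?ltW // exprMn t2; lra.
have num0 : 0 <= 4 * s ^+ 2 * (t - s) - t.
  have : 0 <= (4 * s ^+ 2 * (t - s) - t) * (t + s).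
    have : t * s <= 2 * s * s by rewrite ler_wpM2r // ltW.
    by rewrite e2 t2; rewrite expr2 in s1 *; lra.
  by rewrite pmulr_lge0 // addr_gt0.
have : 0 <= (4 * s ^+ 2 * (t - s) - t) / (s ^+ 3 * t).
  by rewrite divr_ge0 // mulr_ge0 ?exprn_ge0 ?ltW.
rewrite -e1; lra.
Qed.

Lemma lattice_moment (R : realType) d (v : 'rV[int]_d) : (5 <= d)%N ->
  exists C, forall N, \sum_(l < N) l%:R * return_prob R (@lattice d) (2 * d) v l <= C.
Proof.
move=> d5; have d0 : (0 < d)%N by apply: leq_trans d5.
pose B : R := 2^-1 * (d%:R ^+ 5 + 1); exists (B * 4) => N.
have B0 : 0 <= B by rewrite mulr_ge0 ?invr_ge0 // addr_ge0 ?exprn_ge0.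
apply: (@le_trans _ _ (\sum_(l < N) B * (l.+1%:R * Num.sqrt l.+1%:R)^-1)); last first.
  rewrite -mulr_sumr ler_wpM2l //; apply: le_trans (sum_inv_three_halves R N) _.
  by rewrite gerBl divr_ge0.
apply: ler_sum => l _.
set s := Num.sqrt (l.+1%:R : R).
have s0 : 0 < s by rewrite sqrtr_gt0 ltr0n.
have s2 : s ^+ 2 = l.+1%:R by rewrite sqr_sqrtr.
(* c = (l + 1) ^ (5/2) balances the two terms. *)
have := @lattice_return_le d R d0 v l (s ^+ 5) d5 (exprn_gt0 _ s0).
set p := return_prob _ _ _ _ _ => pl.
have e : 2^-1 * (s ^+ 5 * (d%:R ^+ 5 / l.+1%:R ^+ 5) + (s ^+ 5)^-1) = B / s ^+ 5.
  by rewrite -s2 /B; field; rewrite gt_eqF.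
rewrite e in pl.
apply: (@le_trans _ _ (s ^+ 2 * (B / s ^+ 5))).
  apply: ler_pM => //; first exact: return_prob_ge0.
  by rewrite s2 ler_nat.
rewrite -s2 le_eqVlt; apply/orP; left; apply/eqP.
by field; exact: lt0r_neq0.
Qed.

Theorem theorem1p1 :
  (forall (R : realType) (V : choiceType) (H : rel V) (v : V)
     (disp : measure_display) (Omega : measurableType disp)
     (P : probability Omega R) (X Y : nat -> Omega -> V),
     symmetric H -> irreflexive H ->
     infinite_set [set: V] -> locally_finite H -> vertex_transitive H ->
     is_simple_random_walk P X H v ->
     strongly_transient P X v ->
     is_Psi_of_trace P X Y ->
     (0 < limn_einf (fun n => P [set w | Y n w = v]))%E)
  /\
  (forall (R : realType) (d : nat) (v : 'rV[int]_d)
     (disp : measure_display) (Omega : measurableType disp)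
     (P : probability Omega R) (X Y : nat -> Omega -> 'rV[int]_d),
     (5 <= d)%N ->
     is_simple_random_walk P X (@lattice d) v ->
     is_Psi_of_trace P X Y ->
     (0 < limn_einf (fun n => P [set w | Y n w = v]))%E).
Proof.
split=> [R V H v disp Omega P X Y symH _ _ lfH trH|R d v disp Omega P X Y d5 srw PsiY].
  exact: strongly_transient_Psi_liminf.
have [C hC] := lattice_moment R v d5.
exact: (Psi_liminf (@lattice_locally_finite d) (@lattice_transitive d)
  (@lattice_sym d) (@lattice_degree d) srw PsiY hC).
Qed.
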